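(* Let $X_1,\dots,X_m$ ($m\ge 2$) be LC-balanced complex manifolds such that the product $X_1\times\cdots\times X_m$ is compact. Then the compact complex manifold $X_1\times\cdots\times X_m$ is LC-balanced.
   Context: A Hermitian metric on a complex manifold is identified with its positive-definite $C^\infty$ $(1,1)$-form $\omega$. A complex manifold $X$ of complex dimension $n>1$ is called locally conformally balanced (LC-balanced) if it admits a Hermitian metric $\omega$ (an LC-balanced metric) and a closed real 1-form $\theta$ (the Lee form) such that $d\omega^{n-1}=\theta\wedge\omega^{n-1}$. *)

(* Defs.v *)
From HB Require Import structures.
From mathcomp Require Import all_boot all_order all_fingroup all_algebra.
From mathcomp Require Import complex.
From mathcomp Require Import all_classical all_reals topology.
From mathcomp Require Import normedtype derive.

Set Implicit Arguments.
Unset Strict Implicit.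
Unset Printing Implicit Defensive.

Import Order.TTheory GRing.Theory Num.Theory numFieldNormedType.Exports.

Local Open Scope classical_set_scope.
Local Open Scope ring_scope.

(* R[i] seen through [numClosedFieldType], so that ['rV[Cplx R]_n] gets the
   normed-module structure over the complex numbers; in particular
   [differentiable] and ['d] are complex differentiability and the complex
   (holomorphic) differential. *)
Definition Cplx (R : realType) : numClosedFieldType := R[i]%C.

Definition ofreal (R : realType) (t : R) : Cplx R := (t%:C)%C.

(* The derivative of f at x along the real line x + R v. *)
Definition rderivable (R : realType) (n : nat) (v : 'rV[Cplx R]_n)
    (f : 'rV[Cplx R]_n -> R) (x : 'rV[Cplx R]_n) : Prop :=
  derivable (fun t : R => f (x + ofreal t *: v)) 0 1.

Definition rderive (R : realType) (n : nat) (v : 'rV[Cplx R]_n)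
    (f : 'rV[Cplx R]_n -> R) (x : 'rV[Cplx R]_n) : R :=
  derive1 (fun t : R => f (x + ofreal t *: v)) 0.

(* Real differentiability classes C^k and C^oo on an open subset U of C^n. *)
Fixpoint class_C (k : nat) (R : realType) (n : nat) (U : set 'rV[Cplx R]_n)
    (f : 'rV[Cplx R]_n -> R) : Prop :=
  {in U, continuous f} /\
  (if k is l.+1 then
     forall v : 'rV[Cplx R]_n,
       (forall x, U x -> rderivable v f x) /\ class_C l U (rderive v f)
   else True).

Definition smooth_on (R : realType) (n : nat) (U : set 'rV[Cplx R]_n)
    (f : 'rV[Cplx R]_n -> R) : Prop :=
  forall k : nat, class_C k U f.

(* A-valued k-forms on C^n, seen as a real vector space; the k vectors to which
   a form is applied are the rows of a matrix. *)
Definition kform (R : realType) (n : nat) (A : Type) (k : nat) : Type :=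
  'M[Cplx R]_(k, n) -> A.

(* Multilinearity is over the real numbers only. *)
Definition alternating_form (R : realType) (n k : nat) (a : kform R n R k) :
    Prop :=
  (forall (i : 'I_k) (b c : R) (u v w : 'M[Cplx R]_(k, n)),
     row i u = ofreal b *: row i v + ofreal c *: row i w ->
     row' i v = row' i u -> row' i w = row' i u ->
     a u = b * a v + c * a w) /\
  (forall (i j : 'I_k) (v : 'M[Cplx R]_(k, n)),
     i != j -> row i v = row j v -> a v = 0).

(* The convention is (dx /\ dy)(u, v) = dx(u) dy(v) - dx(v) dy(u). *)
Definition wedge (R : realType) (n : nat) (A : fieldType) (p q : nat)
    (a : kform R n A p) (b : kform R n A q) : kform R n A (p + q) :=
  fun v => (p`! * q`!)%:R^-1 *
    \sum_(s : 'S_(p + q))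
      (-1) ^+ s * (a (usubmx (row_perm s v)) * b (dsubmx (row_perm s v))).

(* The degree (k.+1).*2 is convertible to 2 + k.*2. *)
Fixpoint wedge_exp (R : realType) (n : nat) (A : fieldType)
    (a : kform R n A 2) (k : nat) : kform R n A k.*2 :=
  match k return kform R n A k.*2 with
  | 0 => fun _ => 1
  | l.+1 => wedge a (@wedge_exp R n A a l)
  end.

Arguments wedge_exp {R n A} a k.

Definition pullback (R : realType) (n p : nat) (A : Type) (k : nat)
    (L : 'rV[Cplx R]_n -> 'rV[Cplx R]_p) (a : kform R p A k) : kform R n A k :=
  fun v => a (\matrix_(i < k) L (row i v)).

Definition ext_d (R : realType) (n k : nat)
    (a : 'rV[Cplx R]_n -> kform R n R k) :
    'rV[Cplx R]_n -> kform R n R k.+1 :=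
  fun x v => \sum_(i < k.+1)
    (-1) ^+ i * rderive (row i v) (fun y => a y (row' i v)) x.

Definition dz (R : realType) (n : nat) (j : 'I_n) : kform R n (Cplx R) 1 :=
  fun v => v 0 j.

Definition dzbar (R : realType) (n : nat) (j : 'I_n) : kform R n (Cplx R) 1 :=
  fun v => (v 0 j)^*.

(* a = i \sum_(j, k) h_jk dz_j /\ dzbar_k with h Hermitian positive definite. *)
Definition positive_11 (R : realType) (n : nat) (a : kform R n R 2) : Prop :=
  exists h : 'M[Cplx R]_n,
    [/\ forall j k, h k j = (h j k)^*,
        forall u : 'rV[Cplx R]_n, u != 0 ->
          0 < \sum_j \sum_k h j k * u 0 j * (u 0 k)^* &
        forall v, ofreal (a v) =
          ('i)%C * \sum_j \sum_k h j k * wedge (dz j) (dzbar k) v].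

(* The data of an atlas; the values of [chart i] outside [chart_dom i], and of
   [chart_inv i] outside the image [chart_codom i], are irrelevant. *)
Record charted_space (R : realType) (n : nat) := ChartedSpace {
  space :> topologicalType;
  chart_index : Type;
  chart_dom : chart_index -> set space;
  chart : chart_index -> space -> 'rV[Cplx R]_n;
  chart_inv : chart_index -> 'rV[Cplx R]_n -> space
}.

Definition chart_codom (R : realType) (n : nat) (X : charted_space R n)
    (i : chart_index X) : set 'rV[Cplx R]_n :=
  chart i @` chart_dom i.

Definition transition (R : realType) (n : nat) (X : charted_space R n)
    (i j : chart_index X) : 'rV[Cplx R]_n -> 'rV[Cplx R]_n :=
  chart j \o chart_inv i.

Definition homeomorphic_chart (R : realType) (n : nat) (X : charted_space R n)
    (i : chart_index X) : Prop :=
  [/\ open (chart_dom i),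
      open (chart_codom i),
      {in chart_dom i, cancel (chart i) (chart_inv i)},
      {in chart_dom i, continuous (chart i)} &
      {in chart_codom i, continuous (chart_inv i)}].

Definition complex_manifold (R : realType) (n : nat) (X : charted_space R n) :
    Prop :=
  [/\ hausdorff_space X,
      @second_countable X,
      forall x : X, exists i : chart_index X, chart_dom i x,
      forall i : chart_index X, homeomorphic_chart i &
      forall (i j : chart_index X) (x : X), chart_dom i x -> chart_dom j x ->
        differentiable (transition i j) (chart i x)].

(* A differential form on X is given by its local expressions in the charts of
   the atlas; [smooth_form] below asks that they agree on overlaps. *)
Definition local_forms (R : realType) (n : nat) (X : charted_space R n)
    (k : nat) : Type :=
  chart_index X -> 'rV[Cplx R]_n -> kform R n R k.

Definition smooth_form (R : realType) (n : nat) (X : charted_space R n)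
    (k : nat) (a : local_forms X k) : Prop :=
  [/\ forall i x, chart_codom i x -> alternating_form (a i x),
      forall i v, smooth_on (chart_codom i) (fun x => a i x v) &
      forall i j x, chart_dom i x -> chart_dom j x ->
        a i (chart i x) =
        pullback ('d (transition i j) (chart i x)) (a j (chart j x))].

Definition hermitian_metric (R : realType) (n : nat) (X : charted_space R n)
    (w : local_forms X 2) : Prop :=
  smooth_form w /\ forall i x, chart_codom i x -> positive_11 (w i x).

Definition closed_form (R : realType) (n : nat) (X : charted_space R n)
    (k : nat) (a : local_forms X k) : Prop :=
  forall i x, chart_codom i x -> ext_d (a i) x = (fun=> 0).

Definition LC_balanced (R : realType) (n : nat) (X : charted_space R n) :
    Prop :=
  [/\ complex_manifold X, (1 < n)%N &
      exists (w : local_forms X 2) (theta : local_forms X 1),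
        [/\ hermitian_metric w,
            smooth_form theta,
            closed_form theta &
            forall i x, chart_codom i x ->
              ext_d (fun y => wedge_exp (w i y) n.-1) x =
              wedge (theta i x) (wedge_exp (w i x) n.-1)]].

(* The charts are products of charts, with C^n_1 x ... x C^n_m identified with
   C^(n_1 + ... + n_m). *)
Definition prod_charted (R : realType) (m : nat) (n : 'I_m -> nat)
    (X : forall i, charted_space R (n i)) :
    charted_space R (\sum_(i < m) n i) :=
  @ChartedSpace R (\sum_(i < m) n i)
    (prod_topology (fun i => space (X i)))
    (forall i, chart_index (X i))
    (fun c => [set x | forall i, chart_dom (c i) (x i)])
    (fun c x => \mxrow_(i < m) chart (c i) (x i))
    (fun c y i => chart_inv (c i) (submxrow y i)).

(* Main.v *)
Require Import Defs.
From HB Require Import structures.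
From mathcomp Require Import all_boot all_order all_fingroup all_algebra.
From mathcomp Require Import complex.
From mathcomp Require Import all_classical all_reals topology.
From mathcomp Require Import normedtype derive realfun.
From mathcomp Require Import ring lra zify.

Set Implicit Arguments.
Unset Strict Implicit.
Unset Printing Implicit Defensive.

Import Order.TTheory GRing.Theory Num.Theory numFieldNormedType.Exports.

Local Open Scope classical_set_scope.
Local Open Scope ring_scope.

(** On the product, take omega = sum_i omega_i and theta = sum_i theta_i, the
    sums of the pullbacks along the projections.  In a product chart, of complex
    dimension N = sum_i n_i, a term of the expansion of omega^(N-1) vanishes for
    degree reasons unless one factor k contributes omega_k^(n_k - 1) and every
    other factor l its top power omega_l^(n_l).  The top powers are closed, so d
    turns omega_k^(n_k - 1) into theta_k /\ omega_k^(n_k - 1) and leaves the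
    rest, and theta_k can then be replaced with theta, because
    theta_l /\ omega_l^(n_l) = 0.

    This argument is carried out on values, without expanding the power.  The
    value of omega^k on v_1, ..., v_2k is k! times the Pfaffian of the matrix
    omega (v_i, v_j) ([wedge_exp_pfaff]), and the Pfaffian of two orthogonal
    families put together is the product of their Pfaffians ([pfaff_cat]).  The
    twisted differential d - theta /\ is an alternating sum of first order
    operators that depend linearly on a direction, because directional
    derivatives of a C^1 function do ([class_C1_linear]).  Decomposing the
    direction, it is the sum over k of operators that only differentiate along
    the factor k ([twisted_d_blocks]).

    For each k, the result is alternating and multilinear in the 2N - 1 vectors,
    so it is tested on distinct elements of a real basis adapted to the product,
    with those in the factor k placed first ([basis_reduction]).  There it is
    the twisted differential of the factor k on these vectors times the Pfaffian
    of the others ([block_twisted_d_cat]).  The factor k and the rest of the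
    product have 2 n_k and 2 (N - n_k) basis vectors: either exactly 2 n_k - 1
    of the vectors lie in the factor k, and the hypothesis on this factor
    applies, or the number of the other vectors is odd, and their Pfaffian is
    zero ([block_twisted_d_basis]).

    It remains to see that the product of manifolds is a manifold, with
    holomorphic transitions computed block by block, and that sums of pullbacks
    of smooth, closed or positive forms are again so. *)

(** * Alternating sums over lists and Pfaffians *)

Section AlternatingSums.
Variables (V : eqType) (F : numFieldType).
Implicit Types (g : V -> seq V -> F) (f : seq V -> F) (s r : seq V) (u : V).

(** The sum of (-1)^i g (s_i, s without s_i) over the positions i of s.  The
    recursion on s spares the arithmetic of indices. *)
Fixpoint altsum g s : F :=
  if s is u :: s' then g u s' - altsum (fun w r => g w (u :: r)) s' else 0.

(** The pairs at which [g] is evaluated are permutations of [s]; this one fact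
    gives every side condition needed below, on sizes and on membership. *)
Lemma eq_altsum g g' s :
    (forall u r, perm_eq (u :: r) s -> g u r = g' u r) ->
  altsum g s = altsum g' s.
Proof.
elim: s g g' => [//|u s IHs] g g' eq_gg' /=.
rewrite eq_gg' ?perm_refl//; congr (_ - _); apply: IHs => w r pwr.
apply: eq_gg'; rewrite -cat1s (perm_catCA [:: w] [:: u] r) /=.
by rewrite perm_cons.
Qed.

Lemma altsum_eq0 g s :
  (forall u r, perm_eq (u :: r) s -> g u r = 0) -> altsum g s = 0.
Proof.
move=> g0; rewrite (eq_altsum (g' := fun _ _ => 0)) //.
by elim: s {g0} => //= u s ->; rewrite subr0.
Qed.

Lemma altsumMr g c s : altsum (fun u r => g u r * c) s = altsum g s * c.
Proof.
by elim: s g => [|u s IHs] g /=; rewrite ?mul0r// (IHs (fun w r => _)) mulrBl.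
Qed.

Lemma altsumMl g c s : altsum (fun u r => c * g u r) s = c * altsum g s.
Proof.
by rewrite mulrC -altsumMr; apply: eq_altsum => u r _; rewrite mulrC.
Qed.

(** Leibniz rule: the selected element is in one of the two parts. *)
Lemma altsum_cat g s1 s2 :
  altsum g (s1 ++ s2) = altsum (fun u r => g u (r ++ s2)) s1 +
    (-1) ^+ size s1 * altsum (fun u r => g u (s1 ++ r)) s2.
Proof.
elim: s1 g => [|u s1 IHs] g /=; first by rewrite add0r mul1r.
by rewrite (IHs (fun w r => _)) exprS; ring.
Qed.

Variable b : V -> V -> F.

(** For an alternating [f], twice the value on [s] of the wedge product of [b]
    with [f]. *)
Definition contract2 f s : F :=
  altsum (fun u r => altsum (fun w r' => b u w * f r') r) s.

Lemma eq_contract2 f f' s :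
    (forall u w r, perm_eq (u :: w :: r) s -> f r = f' r) ->
  contract2 f s = contract2 f' s.
Proof.
move=> eq_ff'; apply: eq_altsum => u r pur; apply: eq_altsum => w r' pwr.
by rewrite (eq_ff' u w)// (permPr (_ : perm_eq s (u :: r))) ?perm_cons// perm_sym.
Qed.

(** For orthogonal lists the two elements fed to [b] come from the same part;
    those of the second part move past the first one together, so that the signs
    cancel and no sign remains. *)
Lemma contract2_cat f s1 s2 :
    {in s1 & s2, forall u w, b u w = 0 /\ b w u = 0} ->
  contract2 f (s1 ++ s2) =
    contract2 (fun r => f (r ++ s2)) s1 + contract2 (fun r => f (s1 ++ r)) s2.
Proof.
move=> b0; rewrite /contract2 altsum_cat; congr (_ + _).
  apply: eq_altsum => u r /perm_mem pur; rewrite altsum_cat.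
  rewrite [X in _ * X]altsum_eq0 ?mulr0 ?addr0// => w r' /perm_mem pwr.
  by rewrite (b0 u w _ _).1 ?mul0r// -?pur -?pwr mem_head.
rewrite -altsumMl; apply: eq_altsum => u r /perm_mem pur; rewrite altsum_cat.
rewrite altsum_eq0 ?add0r; last first.
  move=> w r' /perm_mem pwr.
  by rewrite (b0 w u _ _).2 ?mul0r// -?pur -?pwr mem_head.
by rewrite mulrA -expr2 sqrr_sign mul1r.
Qed.

(** Recursion on a fuel [k], equal to half of the length of [s] in [pfaff]. *)
Fixpoint pfaff_rec k s : F :=
  if k is k'.+1 then (size s)%:R^-1 * contract2 (pfaff_rec k') s
  else (nilp s)%:R.

(** The Pfaffian of the matrix (b (s_i, s_j) - b (s_j, s_i)) / 2.  Expanding over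
    all the ordered pairs of positions and dividing by the length, instead of
    expanding along the first element, keeps both parts of a concatenation on
    the same footing. *)
Definition pfaff s : F := pfaff_rec (size s)./2 s.

(** Euler identity for the Pfaffian, of degree (size s) / 2; it holds for odd
    lengths too, so that parity does not enter the proof of [pfaff_cat]. *)
Lemma pfaffE s : (size s)%:R * pfaff s = contract2 pfaff s.
Proof.
case: s => [|u [|w s]]; first by rewrite /= mul0r.
  by rewrite /pfaff /contract2 /= mulr0 subr0.
rewrite /pfaff /= mulrA divff ?pnatr_eq0// mul1r.
by apply: eq_contract2 => u' w' r /perm_size /= [->].
Qed.

Lemma pfaff_odd s : odd (size s) -> pfaff s = 0.
Proof.
have [n] := ubnP (size s); elim: n s => // n IHn s; rewrite ltnS => les os.
have s0 : (size s)%:R != 0 :> F by rewrite pnatr_eq0; case: (s) os.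
apply: (mulfI s0); rewrite pfaffE mulr0 /contract2.
apply: altsum_eq0 => u r /perm_size ur; apply: altsum_eq0 => w r' /perm_size wr.
rewrite IHn ?mulr0//; move: os les; rewrite -ur /= -wr /=.
  by move=> _; exact: ltnW.
by rewrite negbK.
Qed.

(** By [contract2_cat], both sides satisfy the Euler identity of [pfaffE] for the
    total length: the lengths of the two parts add up like the degrees of the
    factors of a product. *)
Lemma pfaff_cat s1 s2 :
    {in s1 & s2, forall u w, b u w = 0 /\ b w u = 0} ->
  pfaff (s1 ++ s2) = pfaff s1 * pfaff s2.
Proof.
have [n] := ubnP (size (s1 ++ s2)).
elim: n s1 s2 => // n IHn s1 s2; rewrite ltnS => les b0.
have [/nilP|s_n0] := boolP (nilp (s1 ++ s2)).
  by case: s1 {les b0} => //= ->; rewrite /pfaff /= mulr1.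
have {}s_n0 : (size (s1 ++ s2))%:R != 0 :> F by rewrite pnatr_eq0.
apply: (mulfI s_n0); rewrite pfaffE contract2_cat//.
rewrite size_cat natrD mulrDl mulrA pfaffE mulrCA pfaffE.
congr (_ + _); rewrite /contract2 -?altsumMr -?altsumMl; apply: eq_altsum => u r.
  move=> pur; rewrite -altsumMr; apply: eq_altsum => w r' pwr.
  have s1E : perm_eq s1 (u :: w :: r').
    by rewrite perm_sym -(permPr pur) perm_cons.
  rewrite IHn ?mulrA//.
    rewrite size_cat; apply: leq_trans les; rewrite size_cat.
    by rewrite (perm_size s1E) /= !addSn ltnS leqnSn.
  by move=> x y xr; apply: b0; rewrite (perm_mem s1E) !inE xr !orbT.
move=> pur; rewrite -altsumMl; apply: eq_altsum => w r' pwr.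
have s2E : perm_eq s2 (u :: w :: r').
  by rewrite perm_sym -(permPr pur) perm_cons.
rewrite IHn 1?mulrCA//.
  rewrite size_cat; apply: leq_trans les; rewrite size_cat.
  by rewrite (perm_size s2E) /= !addnS ltnS leqnSn.
by move=> x y xs1 yr; apply: b0; rewrite ?(perm_mem s2E) ?inE ?yr ?orbT.
Qed.

End AlternatingSums.

Section AlternatingSumsChange.
Variables (F : numFieldType).

Lemma altsumD (V : eqType) (g h : V -> seq V -> F) s :
  altsum (fun u r => g u r + h u r) s = altsum g s + altsum h s.
Proof.
elim: s g h => [|u s IHs] g h /=; first by rewrite addr0.
by rewrite (IHs (fun w r => _) (fun w r => _)); ring.
Qed.

Lemma altsum_sum (V : eqType) (I : Type) (e : seq I) (g : I -> V -> seq V -> F) s :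
  altsum (fun u r => \sum_(i <- e) g i u r) s = \sum_(i <- e) altsum (g i) s.
Proof.
elim: e => [|i e IHe].
  by rewrite big_nil altsum_eq0// => u r _; rewrite big_nil.
by rewrite big_cons -IHe -altsumD; apply: eq_altsum => u r _; rewrite big_cons.
Qed.

Lemma altsum_map (V W : eqType) (h : V -> W) (g : W -> seq W -> F) s :
  altsum g (map h s) = altsum (fun u r => g (h u) (map h r)) s.
Proof. by elim: s g => //= u s IHs g; rewrite IHs. Qed.

Lemma pfaff_map (V W : eqType) (h : V -> W) (b : W -> W -> F) s :
  pfaff b (map h s) = pfaff (fun u w => b (h u) (h w)) s.
Proof.
rewrite /pfaff size_map.
move: (size s)./2 => k; elim: k s => [|k IHk] s /=; first by case: s.
rewrite size_map /contract2 altsum_map; congr (_ * _).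
by apply: eq_altsum => u r _; rewrite altsum_map; apply: eq_altsum => w r' _;
  rewrite IHk.
Qed.

Lemma eq_pfaff (V : eqType) (b b' : V -> V -> F) s :
  {in s &, b =2 b'} -> pfaff b s = pfaff b' s.
Proof.
rewrite /pfaff; move: (size s)./2 => k; elim: k s => [//|k IHk] s /= bb'.
congr (_ * _); apply: eq_altsum => u r pur; apply: eq_altsum => w r' pwr.
have sE : perm_eq s (u :: w :: r') by rewrite perm_sym -(permPr pur) perm_cons.
rewrite bb' ?(perm_mem sE) ?inE ?eqxx ?orbT//; congr (_ * _); apply: IHk.
by move=> x y xr yr; apply: bb'; rewrite (perm_mem sE) !inE ?xr ?yr !orbT.
Qed.

Lemma pfaff_linear_head (V : eqType) (b : V -> V -> F) (c d : F) (u v w : V) s :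
    (forall x, b u x = c * b v x + d * b w x) ->
    (forall x, b x u = c * b x v + d * b x w) ->
  pfaff b (u :: s) = c * pfaff b (v :: s) + d * pfaff b (w :: s).
Proof.
move=> bl br; have [k] := ubnP (size s); elim: k s => // k IHk s; rewrite ltnS => sk.
have s0 : (size s).+1%:R != 0 :> F by rewrite pnatr_eq0.
apply/(mulfI s0); rewrite mulrDr (mulrCA _ c) (mulrCA _ d).
rewrite (pfaffE b (u :: s)) (pfaffE b (v :: s)) (pfaffE b (w :: s)).
rewrite /contract2 /= !mulrBr addrACA -opprD -!altsumMl -!altsumD.
congr (_ - _); apply: eq_altsum => x r pxr; first by rewrite bl; ring.
rewrite br !mulrBr addrACA -opprD -!altsumMl -!altsumD mulrDl !mulrA.
congr (_ - _); apply: eq_altsum => y r' pyr; rewrite IHk; first by ring.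
by apply: leq_trans sk; rewrite -(perm_size pxr) /= -(perm_size pyr) /= leqnSn.
Qed.

End AlternatingSumsChange.

(** * Sums over permutations, expanded along a row *)

Section PermutationSums.
Variables (K : Type) (n : nat) (A : comNzRingType).

Definition antisymmetric_fun k (f : 'M[K]_(k, n) -> A) : Prop :=
  forall (t : 'S_k) v, f (row_perm t v) = (-1) ^+ t * f v.

Definition antisymmetrize k (f : 'M[K]_(k, n) -> A) : 'M[K]_(k, n) -> A :=
  fun v => \sum_(s : 'S_k) (-1) ^+ s * f (row_perm s v).

Definition row_altsum k (g : 'rV[K]_n -> 'M[K]_(k, n) -> A) :
    'M[K]_(k.+1, n) -> A :=
  fun v => \sum_(i < k.+1) (-1) ^+ i * g (row i v) (row' i v).

Lemma antisymmetrize_antisymmetric k (f : 'M[K]_(k, n) -> A) :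
  antisymmetric_fun (antisymmetrize f).
Proof.
move=> t v; rewrite /antisymmetrize (reindex_inj (mulIg t^-1%g)) big_distrr /=.
apply: eq_bigr => s _; rewrite odd_permM odd_permV signr_addb.
rewrite mulrA [in RHS](mulrC _ (_ ^+ s)); congr (_ * f _).
by rewrite -row_permM mulgKV.
Qed.

Lemma antisymmetrize_id k (f : 'M[K]_(k, n) -> A) v :
  antisymmetric_fun f -> antisymmetrize f v = k`!%:R * f v.
Proof.
move=> fA; rewrite /antisymmetrize (eq_bigr (fun=> f v)) => [|s _]; last first.
  by rewrite fA mulrA -expr2 sqrr_sign mul1r.
by rewrite sumr_const -cardsE cardsT card_Sn mulr_natl.
Qed.

(** Sort the permutations s of k + 1 rows by the value i of s at 0: those that
    remain permute the other k rows, and the cycle that brings row i in front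
    has sign (-1)^i. *)
Lemma antisymmetrize_row k (g : 'rV[K]_n -> 'M[K]_(k, n) -> A) v :
  antisymmetrize (fun u => g (row 0 u) (row' 0 u)) v =
  row_altsum (fun u => antisymmetrize (g u)) v.
Proof.
rewrite /antisymmetrize /row_altsum.
rewrite (partition_big (fun s : 'S_k.+1 => s 0) predT) //=.
apply: eq_bigr => i _; rewrite big_distrr /=.
rewrite (reindex (lift_perm 0 i)); last first.
  pose ulsf i (s : 'S_k.+1) j := odflt j (unlift i (s (lift 0 j))).
  have ulsfK i' (s : 'S_k.+1) j : s 0 = i' -> lift i' (ulsf i' s j) = s (lift 0 j).
    rewrite /ulsf => si; case: unliftP => [j' //|eq_s].
    by move: (neq_lift (0 : 'I_k.+1) j); rewrite -(inj_eq (@perm_inj _ s)) si eq_s eqxx.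
  have ulsf_inj (s : 'S_k.+1) (si : s 0 = i) : injective (ulsf i s).
    move=> j1 j2 /(congr1 (lift i)); rewrite !ulsfK//.
    by move=> /perm_inj /lift_inj.
  exists (fun s : 'S_k.+1 =>
    if s 0 =P i is ReflectT si then perm (ulsf_inj s si) else 1%g).
    move=> s _; case: eqP => [si|]; last by rewrite lift_perm_id.
    apply/permP => j; rewrite permE; apply: (@lift_inj _ i).
    by rewrite ulsfK// lift_perm_lift.
  move=> s /eqP si; case: eqP => // si'.
  apply/permP => j; case: (unliftP 0 j) => [j'|] ->; last by rewrite lift_perm_id.
  by rewrite lift_perm_lift permE ulsfK.
apply: eq_big => [s|s _]; first by rewrite lift_perm_id eqxx.
rewrite odd_lift_perm 2!signr_addb mul1r signr_odd [in RHS]mulrA; congr (_ * g _ _).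
  by apply/rowP => j; rewrite !mxE lift_perm_id.
by apply/matrixP => a j; rewrite !mxE lift_perm_lift.
Qed.

(** The form in which [antisymmetrize_row] is used: alternating sums of
    antisymmetric functions are antisymmetric. *)
Lemma row_altsum_antisymmetrize k (g : 'rV[K]_n -> 'M[K]_(k, n) -> A) v :
    (forall u, antisymmetric_fun (g u)) ->
  k`!%:R * row_altsum g v = antisymmetrize (fun u => g (row 0 u) (row' 0 u)) v.
Proof.
move=> gA; rewrite antisymmetrize_row /row_altsum big_distrr /=.
by apply: eq_bigr => i _; rewrite antisymmetrize_id// mulrCA.
Qed.

End PermutationSums.

Section RowLists.
Variables (K : Type) (n : nat).

(** Matrices are the arguments of forms, but lists of rows can be concatenated
    without casts. *)
Definition rows k (v : 'M[K]_(k, n)) : seq 'rV[K]_n :=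
  [seq row i v | i <- enum 'I_k].

Lemma size_rows k (v : 'M[K]_(k, n)) : size (rows v) = k.
Proof. by rewrite size_map size_enum_ord. Qed.

Lemma rowsS k (v : 'M[K]_(k.+1, n)) : rows v = row 0 v :: rows (row' 0 v).
Proof.
rewrite /rows enum_ordSl /= -map_comp; congr (_ :: _); apply: eq_map => i /=.
by apply/rowP => j; rewrite !mxE.
Qed.

End RowLists.

Section RowLists2.
Variables (K : eqType) (n : nat) (A : numFieldType).

Lemma row_altsumE k (g : 'rV[K]_n -> 'M[K]_(k, n) -> A) g' (v : 'M[K]_(k.+1, n)) :
    (forall u r, g u r = g' u (rows r)) ->
  row_altsum g v = altsum g' (rows v).
Proof.
rewrite /row_altsum => gg'.
transitivity (\sum_(i < k.+1) (-1) ^+ i * g' (row i v) (rows (row' i v))).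
  by apply: eq_bigr => i _; rewrite gg'.
elim: k v {g gg'} g' => [|k IHk] v g; rewrite big_ord_recl mul1r rowsS /=.
  by rewrite big_ord0 [rows (row' 0 v)]size0nil ?size_rows//= subr0 addr0.
congr (_ + _); rewrite -(IHk (row' 0 v) (fun w r => g w (row 0 v :: r))) -sumrN.
apply: eq_bigr => i _; rewrite /bump /= add1n exprS mulN1r mulNr; congr (- (_ * g _ _)).
  by apply/rowP => j; rewrite !mxE.
rewrite [LHS]rowsS; congr cons; last congr rows.
  by apply/rowP => j; rewrite !mxE; congr (v _ _); apply/val_inj; case: i => -[].
apply/matrixP => a j; rewrite !mxE; congr (v _ _).
by apply/val_inj => /=; rewrite /bump; lia.
Qed.
End RowLists2.

(** * Wedge products as alternating sums *)

Section WedgeFormulas.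
Variables (R : realType) (n : nat) (A : numFieldType).

Lemma fact_neq0 k : k`!%:R != 0 :> A.
Proof. by rewrite pnatr_eq0 -lt0n fact_gt0. Qed.

Lemma wedgeE p q (a : kform R n A p) (b : kform R n A q) v :
  wedge a b v = (p`! * q`!)%:R^-1 *
    antisymmetrize (fun u => a (usubmx u) * b (dsubmx u)) v.
Proof. by []. Qed.

Lemma wedge_antisymmetric p q (a : kform R n A p) (b : kform R n A q) :
  antisymmetric_fun (wedge a b).
Proof. by move=> t v; rewrite !wedgeE antisymmetrize_antisymmetric mulrCA. Qed.

Lemma wedge_exp_antisymmetric (a : kform R n A 2) k :
  antisymmetric_fun (wedge_exp a k).
Proof.
case: k => [|k]; last exact: (@wedge_antisymmetric 2 k.*2).
by move=> t v; rewrite (_ : t = 1%g) ?odd_perm1 ?mul1r//; apply/permP => -[].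
Qed.

(** The q! permutations of the arguments of [b] contribute equally. *)
Lemma wedge_1l q (a : kform R n A 1) (b : kform R n A q) v :
  antisymmetric_fun b ->
  wedge a b v = row_altsum (fun u r => a u * b r) v.
Proof.
move=> bA; rewrite wedgeE mul1n; apply: canLR (mulKf (fact_neq0 q)) _.
rewrite row_altsum_antisymmetrize => [|u t r]; last by rewrite bA mulrCA.
apply: eq_bigr => s _; congr (_ * (a _ * b _)).
  by apply/matrixP => i j; rewrite !mxE !ord1; congr (v (s _) _); apply/val_inj.
by apply/matrixP => i j; rewrite !mxE; congr (v (s _) _); apply/val_inj.
Qed.

Definition form2 (a : kform R n A 2) (u w : 'rV[Cplx R]_n) : A :=
  a (col_mx u w : 'M_(1 + 1, n)).

(** Two successive expansions along a row choose the arguments of [a]; the factor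
    2 counts their orders. *)
Lemma wedge_2l q (a : kform R n A 2) (b : kform R n A q) v :
  antisymmetric_fun b ->
  2%:R * wedge a b v =
  row_altsum (fun u => row_altsum (fun w r => form2 a u w * b r)) v.
Proof.
move=> bA; rewrite wedgeE natrM invfM -mulrA (mulVKf (fact_neq0 2)).
apply: canLR (mulKf (fact_neq0 q)) _.
pose g u (r : 'M[Cplx R]_(q.+1, n)) := form2 a u (row 0 r) * b (row' 0 r).
transitivity (antisymmetrize (fun u => g (row 0 u) (row' 0 u)) v).
  apply: eq_bigr => s _; congr (_ * (a _ * b _)).
    apply/matrixP => i j; rewrite !mxE; case: split_ordP => k ->;
      by rewrite !mxE; congr (v (s _) _); apply/val_inj; rewrite /= ord1.
  by apply/matrixP => i j; rewrite !mxE; congr (v (s _) _); apply/val_inj.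
rewrite antisymmetrize_row /row_altsum big_distrr /=; apply: eq_bigr => i _.
rewrite mulrCA; congr (_ * _).
rewrite (antisymmetrize_row (fun w r => form2 a (row i v) w * b r)).
rewrite /row_altsum big_distrr /=; apply: eq_bigr => j _.
by rewrite antisymmetrize_id 1?mulrCA// => t r; rewrite bA mulrCA.
Qed.

(** Wedge powers satisfy the recursion of [pfaffE] up to the factorial. *)
Lemma wedge_exp_pfaff (a : kform R n A 2) k v :
  wedge_exp a k v = k`!%:R * pfaff (form2 a) (rows v).
Proof.
elim: k v => [|k IHk] v.
  by rewrite /pfaff [rows v]size0nil ?size_rows//= mulr1.
apply: (@mulfI _ 2%:R); first by rewrite pnatr_eq0.
rewrite [LHS](wedge_2l a v (@wedge_exp_antisymmetric a k)).
transitivity (k`!%:R * contract2 (form2 a) (pfaff (form2 a)) (rows v)).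
  rewrite (@row_altsumE _ _ _ _ _ (fun u r =>
    altsum (fun w r' => form2 a u w * (k`!%:R * pfaff (form2 a) r')) r)).
    rewrite -altsumMl; apply: eq_altsum => u r _; rewrite -altsumMl.
    by apply: eq_altsum => w r' _; rewrite mulrCA.
  by move=> u r; apply: row_altsumE => w r'; rewrite IHk.
rewrite -pfaffE size_rows; move: (pfaff _ _) => P; rewrite factS -muln2 !natrM; ring.
Qed.

End WedgeFormulas.

(** * Derivatives along real lines *)

Section Ofreal.
Variable R : realType.
Implicit Types s t : R.

Lemma ofrealD s t : ofreal (s + t) = ofreal s + ofreal t.
Proof. exact: (raddfD (real_complex R)). Qed.
Lemma ofrealM s t : ofreal (s * t) = ofreal s * ofreal t.
Proof. exact: (rmorphM (real_complex R)). Qed.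
Lemma ofrealB s t : ofreal (s - t) = ofreal s - ofreal t.
Proof. exact: (raddfB (real_complex R)). Qed.
Lemma ofreal0 : ofreal (0 : R) = 0. Proof. by []. Qed.
Lemma ofreal1 : ofreal (1 : R) = 1. Proof. by []. Qed.

Lemma ofreal_continuous : continuous (@ofreal R).
Proof.
move=> t; apply/cvgrPdist_lt => -[a b]; rewrite ltcE /= => /andP[/eqP b0 a0].
near=> s; rewrite -ofrealB.
rewrite b0 normc_def /= expr0n /= addr0 sqrtr_sqr ltcR.
near: s; exact: (@cvgr_dist_lt _ _ _ (nbhs t) _ id t).
Unshelve. all: by end_near. Qed.

End Ofreal.

Section RealDerivatives.
Variables (R : realType) (n : nat).
Implicit Types (f g : 'rV[Cplx R]_n -> R) (x u v : 'rV[Cplx R]_n).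
Implicit Types (U : set 'rV[Cplx R]_n).

Definition line f x v (t : R) : R := f (x + ofreal t *: v).

Lemma ray_continuous x v (t : R) : {for t, continuous (fun t : R => x + ofreal t *: v)}.
Proof.
apply: cvgD; first exact: cvg_cst.
by apply: cvgZr_tmp; exact: ofreal_continuous.
Qed.

(** Differentiation along a real line only sees an open set. *)
Lemma near_ray x v U : open U -> U x -> \forall t \near (0:R), U (x + ofreal t *: v).
Proof.
move=> oU Ux; apply: (@ray_continuous x v 0).
by rewrite ofreal0 scale0r addr0; exact: open_nbhs_nbhs.
Qed.

(** Derivability and value of the derivative packed together, to reuse the
    calculus of [is_derive] on the real line. *)
Definition is_rderive x v f (l : R) := is_derive (0 : R) (1 : R) (line f x v) l.

Lemma rderivableP x v f : rderivable v f x -> is_rderive x v f (rderive v f x).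
Proof. by move=> fv; rewrite /is_rderive /rderive derive1E; exact: derivableP. Qed.

Lemma is_rderiveP x v f l : is_rderive x v f l -> rderivable v f x /\ rderive v f x = l.
Proof. by move=> [dl <-]; split; [exact: dl|rewrite /rderive derive1E]. Qed.

Lemma near_is_rderive U f g x v l : open U -> U x -> {in U, f =1 g} ->
  is_rderive x v f l -> is_rderive x v g l.
Proof.
move=> oU Ux fg; apply: near_eq_is_derive.
near=> t; apply: fg; rewrite inE; near: t; exact: near_ray.
Unshelve. all: by end_near. Qed.

Lemma is_rderiveD x v f g l k : is_rderive x v f l -> is_rderive x v g k ->
  is_rderive x v (fun y => f y + g y) (l + k).
Proof. by move=> df dg; exact: is_deriveD. Qed.

Lemma is_rderiveM x v f g l k : is_rderive x v f l -> is_rderive x v g k ->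
  is_rderive x v (fun y => f y * g y) (l * g x + f x * k).
Proof.
move=> df dg; have := @is_deriveM _ _ _ _ _ _ _ _ df dg.
rewrite /line ofreal0 scale0r addr0 /= => H.
by apply: is_derive_eq H _; rewrite /GRing.scale /=; ring.
Qed.

Lemma is_rderive_cst x v (c : R) : is_rderive x v (fun=> c) 0.
Proof. exact: is_derive_cst. Qed.

Lemma is_rderive_sum (I : Type) (r : seq I) x v (f : I -> 'rV[Cplx R]_n -> R) l :
  (forall i, is_rderive x v (f i) (l i)) ->
  is_rderive x v (fun y => \sum_(i <- r) f i y) (\sum_(i <- r) l i).
Proof.
move=> df; elim: r => [|i r IHr].
  rewrite big_nil (_ : (fun y => _) = fun=> 0); first exact: is_rderive_cst.
  by apply/funext => y; rewrite big_nil.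
rewrite big_cons (_ : (fun y => _) = fun y => f i y + \sum_(i <- r) f i y).
  exact: is_rderiveD.
by apply/funext => y; rewrite big_cons.
Qed.

Lemma is_rderive_dir0 x f : is_rderive x 0 f 0.
Proof.
rewrite /is_rderive (_ : line f x 0 = cst (f x)); first exact: is_derive_cst.
by apply/funext => t; rewrite /line scaler0 addr0.
Qed.

(** Moving the base point along the line: the derivative at any time of the
    restriction to a line is again a directional derivative. *)
Lemma is_derive_line x v f (t : R) :
  rderivable v f (x + ofreal t *: v) ->
  is_derive t (1 : R) (line f x v) (rderive v f (x + ofreal t *: v)).
Proof.
move=> /rderivableP; rewrite /is_rderive.
set l := rderive _ _ _ => dl.
have -> : line f x v = line f (x + ofreal t *: v) v \o (fun s => s - t).
  apply/funext => s; rewrite /line /= -addrA -scalerDl -ofrealD.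
  by rewrite [t + _]addrC subrK.
rewrite -[l]mulr1; apply: is_derive1_comp; rewrite ?subrr//.
by apply: is_derive_eq; rewrite subr0.
Qed.

Lemma is_rderiveZdir x v f l (c : R) :
  is_rderive x v f l -> is_rderive x (ofreal c *: v) f (c * l).
Proof.
rewrite /is_rderive => dl.
have -> : line f x (ofreal c *: v) = line f x v \o (fun s => s * c).
  by apply/funext => s; rewrite /line /= scalerA -ofrealM.
rewrite mulrC; apply: is_derive1_comp; rewrite ?mul0r//.
by apply: is_derive_eq; rewrite /GRing.scale /=; ring.
Qed.

(** The mean value theorem from 0 to [t], whatever the sign of [t]. *)
Lemma MVT_at0 (F dF : R -> R) (d t : R) : `|t| < d ->
    (forall s, `|s| < d -> is_derive s (1 : R) F (dF s)) ->
  exists2 c, `|c| < d & F t - F 0 = dF c * t.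
Proof.
move=> td dFd.
have d0 : 0 < d by apply: le_lt_trans td.
have cF (a b : R) : `|a| < d -> `|b| < d -> {within `[a, b], continuous F}.
  move=> /ltr_normlP[a1 a2] /ltr_normlP[b1 b2].
  apply: derivable_within_continuous => s; rewrite in_itv /= => /andP[as_ sb].
  by have [] := dFd s; rewrite ?ltr_norml; [apply/andP; split; lra|].
have dF' (a b : R) : `|a| < d -> `|b| < d ->
    forall s, s \in `]a, b[%R -> is_derive s (1 : R) F (dF s).
  move=> /ltr_normlP[a1 a2] /ltr_normlP[b1 b2] s; rewrite in_itv /=.
  move=> /andP[as_ sb]; apply: dFd; rewrite ltr_norml; apply/andP; split; lra.
have n0d : `|0 : R| < d by rewrite normr0.
have inlt (a b c : R) : `|a| < d -> `|b| < d -> c \in `[a, b]%R -> `|c| < d.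
  move=> /ltr_normlP[a1 a2] /ltr_normlP[b1 b2]; rewrite in_itv /=.
  by move=> /andP[as_ sb]; rewrite ltr_norml; apply/andP; split; lra.
have [t0|t0] := leP 0 t.
  have [c cI ->] := MVT_segment t0 (dF' _ _ n0d td) (cF _ _ n0d td).
  by exists c; [exact: inlt cI|rewrite subr0].
have [c cI E] := MVT_segment (ltW t0) (dF' _ _ td n0d) (cF _ _ td n0d).
by exists c; [exact: inlt cI|rewrite -opprB E sub0r mulrN opprK].
Qed.

(** Write the increment along u + v as an increment along u followed by one
    along v, whose base point moves: the mean value theorem turns the latter into
    a derivative along v at a nearby point, and continuity concludes. *)
Lemma is_rderiveDdir U f x u v : open U -> U x ->
    (forall y, U y -> rderivable v f y) -> rderivable u f x ->
    {for x, continuous (rderive v f)} ->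
  is_rderive x (u + v) f (rderive u f x + rderive v f x).
Proof.
move=> oU Ux dv du cv.
suff H : (fun h : R => h^-1 *: ((line f x (u + v) \o shift 0) (h *: (1 : R)) -
    line f x (u + v) 0)) @ 0^' --> rderive u f x + rderive v f x.
  by apply: DeriveDef; [apply/cvg_ex; eexists; exact: H|exact: cvg_lim H].
have -> : (fun h : R => h^-1 *: ((line f x (u + v) \o shift 0) (h *: (1 : R)) -
    line f x (u + v) 0)) =
  (fun h : R => h^-1 *: ((line f x u \o shift 0) (h *: (1 : R)) - line f x u 0)) \+
  (fun h : R => h^-1 * (line f (x + ofreal h *: u) v h - f (x + ofreal h *: u))).
  have scaleE (a b : R) : a *: b = a * b by [].
  apply/funext => h; rewrite /line /= !scaleE !mulr1 !addr0 -mulrDr.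
  by rewrite !ofreal0 !scale0r !addr0 scalerDr addrA; congr (_ * _); ring.
(* The second difference quotient is along [v], from the moving point
   x + h u. *)
apply: cvgD.
  by have [du1 <-] := rderivableP du; exact: du1.
apply/cvgrPdist_lt => e e0.
have [W [WE oW]] : exists W, W x /\ open W /\ forall y, W y -> U y /\
    `|rderive v f x - rderive v f y| < e.
  have : \forall y \near x, U y /\ `|rderive v f x - rderive v f y| < e.
    near=> y; split; near: y; first exact: open_nbhs_nbhs.
    by move/cvgrPdist_lt: cv; apply.
  by rewrite /prop_near1 nbhsE => -[W [oW Wx] WU]; exists W; split => //; split.
have : \forall t \near (0 : R) & s \near (0 : R), W (x + ofreal t *: u + ofreal s *: v).
  have : (fun ts : R * R => x + ofreal ts.1 *: u + ofreal ts.2 *: v) @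
      (0 : R, 0 : R) --> x + ofreal 0 *: u + ofreal 0 *: v.
    apply: cvgD; first (apply: cvgD; first exact: cvg_cst).
      by apply: cvgZr_tmp; apply: (cvg_comp _ _ cvg_fst); exact: ofreal_continuous.
    by apply: cvgZr_tmp; apply: (cvg_comp _ _ cvg_snd); exact: ofreal_continuous.
  rewrite !ofreal0 !scale0r !addr0 => /(_ W).
  move=> /(_ (open_nbhs_nbhs (conj oW.1 WE))).
  by [].
case=> -[P Q] /= [/nbhs_ballP[d1 /= d10 P1] /nbhs_ballP[d2 /= d20 Q2]] PQ.
pose d := Num.min d1 d2; have d0 : 0 < d by rewrite lt_min d10 d20.
have inW (t s : R) : `|t| < d -> `|s| < d -> W (x + ofreal t *: u + ofreal s *: v).
  rewrite !lt_min => /andP[t1 _] /andP[_ s2]; apply: (PQ (t, s)); split => /=.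
    by apply: P1; rewrite /ball /= sub0r normrN.
  by apply: Q2; rewrite /ball /= sub0r normrN.
near=> h.
have hd : `|h| < d.
  near: h; apply: dnbhs0_lt; exact: d0.
have h0 : h != 0 by near: h; exact: nbhs_dnbhs_neq.
have [c cd E] := MVT_at0 hd (F := line f (x + ofreal h *: u) v)
  (dF := fun s => rderive v f (x + ofreal h *: u + ofreal s *: v))
  (fun s sd => is_derive_line (dv _ (oW.2 _ (inW _ _ hd sd)).1)).
move: E; rewrite {2}/line ofreal0 scale0r addr0 => ->.
rewrite mulrC mulfK//; exact: (oW.2 _ (inW _ _ hd cd)).2.
Unshelve. all: by end_near. Qed.

End RealDerivatives.

Lemma is_rderive_comp (R : realType) (n p : nat) (L : 'rV[Cplx R]_p -> 'rV[Cplx R]_n)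
    y w (f : 'rV[Cplx R]_n -> R) l :
  linear L -> is_rderive (L y) (L w) f l -> is_rderive y w (f \o L) l.
Proof.
move=> linL; rewrite /is_rderive (_ : line (f \o L) y w = line f (L y) (L w))//.
by apply/funext => t; rewrite /line /= addrC linL addrC.
Qed.

(** * Differentiability classes *)

Section SmoothFunctions.
Variables (R : realType) (n : nat).
Implicit Types (f g : 'rV[Cplx R]_n -> R) (x u v : 'rV[Cplx R]_n).
Implicit Types (U : set 'rV[Cplx R]_n).

Lemma near_rderive U f g x v : open U -> U x -> {in U, f =1 g} ->
  rderivable v f x -> rderivable v g x /\ rderive v g x = rderive v f x.
Proof.
move=> oU Ux fg /rderivableP df; apply: is_rderiveP.
exact: (near_is_rderive oU Ux fg).
Qed.

Lemma continuous_in_ext U f g : open U -> {in U, f =1 g} ->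
  {in U, continuous f} -> {in U, continuous g}.
Proof.
move=> oU fg fc x xU; have Ux : U x by rewrite -inE.
have E : {near x, f =1 g}.
  by near=> y; apply: fg; rewrite inE; near: y; exact: open_nbhs_nbhs.
rewrite /continuous_at -fg//; exact: cvg_trans (near_eq_cvg E) (fc x xU).
Unshelve. all: by end_near. Qed.

(** Derivatives computed by rules agree with [rderive] on [U] only, hence the
    need for this extensionality on open sets. *)
Lemma class_C_ext k U f g : open U -> {in U, f =1 g} ->
  class_C k U f -> class_C k U g.
Proof.
move=> oU; elim: k f g => [|k IHk] f g fg [fc df].
  by split => //; exact: continuous_in_ext fc.
split; first exact: continuous_in_ext fc.
move=> v; have [dfv Cfv] := df v; split=> [x Ux|].
  exact: (near_rderive oU Ux fg (dfv _ Ux)).1.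
apply: IHk Cfv => x; rewrite inE => Ux.
by rewrite (near_rderive oU Ux fg (dfv _ Ux)).2.
Qed.

Lemma class_C_cst k U (c : R) : class_C k U (fun=> c).
Proof.
elim: k c => [|k IHk] c; first by split => // x _; exact: cst_continuous.
split; first by move=> x _; exact: cst_continuous.
move=> v; split=> [x Ux|]; first exact: (is_rderiveP (is_rderive_cst x v c)).1.
rewrite (_ : rderive v _ = fun=> 0) //; apply/funext => x.
exact: (is_rderiveP (is_rderive_cst x v c)).2.
Qed.

Lemma class_CD k U f g : open U ->
  class_C k U f -> class_C k U g -> class_C k U (fun y => f y + g y).
Proof.
move=> oU; elim: k f g => [|k IHk] f g [fc df] [gc dg].
  by split => // x xU; exact: cvgD (fc x xU) (gc x xU).
split=> [x xU|v]; first exact: cvgD (fc x xU) (gc x xU).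
have [dfv Cfv] := df v; have [dgv Cgv] := dg v.
have D x (Ux : U x) := is_rderiveP (is_rderiveD (rderivableP (dfv x Ux))
  (rderivableP (dgv x Ux))).
split=> [x Ux|]; first exact: (D x Ux).1.
by apply: class_C_ext (IHk _ _ Cfv Cgv) => // x; rewrite inE => /D[_ ->].
Qed.

Lemma class_C_sum (I : Type) (r : seq I) k U (f : I -> 'rV[Cplx R]_n -> R) :
    open U -> (forall i, class_C k U (f i)) ->
  class_C k U (fun y => \sum_(i <- r) f i y).
Proof.
move=> oU Cf; elim: r => [|i r IHr].
  by apply: class_C_ext (class_C_cst k U 0) => // y _; rewrite big_nil.
apply: class_C_ext (class_CD oU (Cf i) IHr) => // y _.
by rewrite big_cons.
Qed.

Lemma class_C1M U f g : open U ->
  class_C 1 U f -> class_C 1 U g -> class_C 1 U (fun y => f y * g y).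
Proof.
move=> oU [fc df] [gc dg].
split=> [x xU|v]; first exact: cvgM (fc x xU) (gc x xU).
have [dfv [Cfv _]] := df v; have [dgv [Cgv _]] := dg v.
have D x (Ux : U x) := is_rderiveP (is_rderiveM (rderivableP (dfv x Ux))
  (rderivableP (dgv x Ux))).
split=> [x Ux|]; first exact: (D x Ux).1.
split; last exact: I.
apply: (@continuous_in_ext _ (fun y => rderive v f y * g y + f y * rderive v g y)).
- by [].
- by move=> x; rewrite inE => /D[_ ->].
move=> x xU.
exact: cvgD (cvgM (Cfv x xU) (gc x xU)) (cvgM (fc x xU) (Cgv x xU)).
Qed.

Lemma class_C1_rderivable U f x v : class_C 1 U f -> U x -> rderivable v f x.
Proof. by move=> [_ /(_ v)[df _]] /df. Qed.

(** The linear dependence on the direction that lets the exterior differential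
    be decomposed along the factors of a product. *)
Lemma class_C1_linear U f x u v (a b : R) : open U -> U x -> class_C 1 U f ->
  rderive (ofreal a *: u + ofreal b *: v) f x =
  a * rderive u f x + b * rderive v f x.
Proof.
move=> oU Ux Cf; have df w y : U y -> rderivable w f y.
  exact: class_C1_rderivable.
have Z c w := is_rderiveP (is_rderiveZdir c (rderivableP (df w x Ux))).
rewrite -(Z a u).2 -(Z b v).2.
apply: (is_rderiveP (is_rderiveDdir oU Ux (df _) (df _ _ Ux) _)).2.
by have [_ /(_ (ofreal b *: v))[_ [+ _]]] := Cf; apply; rewrite inE.
Qed.

End SmoothFunctions.

(** The derivative of f o L along v is the derivative of f along L v, composed
    with L; hence the induction on [k]. *)
Lemma class_C_comp (R : realType) (n p k : nat) (U : set 'rV[Cplx R]_n)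
    (W : set 'rV[Cplx R]_p) (L : 'rV[Cplx R]_p -> 'rV[Cplx R]_n) f :
    linear L -> continuous L -> open W -> (forall y, W y -> U (L y)) ->
  class_C k U f -> class_C k W (f \o L).
Proof.
move=> linL cL oW WU.
have cfL (g : 'rV[Cplx R]_n -> R) :
    {in U, continuous g} -> {in W, continuous (g \o L)}.
  move=> gc y; rewrite inE => Wy; apply: continuous_comp; first exact: cL.
  by apply: gc; rewrite inE; exact: WU.
elim: k f => [|k IHk] f [fc df]; first by split => //; exact: cfL.
split; first exact: cfL.
move=> v; have [dfv Cfv] := df (L v).
have D y (Wy : W y) := is_rderiveP (is_rderive_comp linL
  (rderivableP (dfv _ (WU _ Wy)))).
split=> [y Wy|]; first exact: (D y Wy).1.
by apply: class_C_ext (IHk _ Cfv) => // y; rewrite inE => /D[_ ->].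
Qed.

(** * Alternating forms tested on a basis *)

Lemma col_mx_unlift (K : Type) n k (u : 'rV[K]_n) (r : 'M[K]_(k, n)) (i : 'I_k.+1) j :
  (col_mx u r : 'M_(1 + k, n)) i j = if unlift 0 i is Some i' then r i' j else u 0 j.
Proof.
case: (unliftP 0 i) => [i'|] ->.
  rewrite (_ : lift 0 i' = rshift 1 i'); last exact: val_inj.
  exact: col_mxEd.
rewrite (_ : 0 = lshift k (0 : 'I_1)); last exact: val_inj.
exact: col_mxEu.
Qed.

Lemma rows_col_mx (K : Type) n k (u : 'rV[K]_n) (r : 'M[K]_(k, n)) :
  rows (col_mx u r : 'M_(1 + k, n)) = u :: rows r.
Proof.
rewrite [LHS]rowsS; congr cons; last congr rows.
  by apply/rowP => j; rewrite mxE col_mx_unlift unlift_none.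
by apply/matrixP => i j; rewrite mxE col_mx_unlift liftK.
Qed.

Lemma rows_inj (K : Type) n k : injective (@rows K n k).
Proof.
move=> v w; elim: k v w => [|k IHk] v w; first by move=> _; apply/matrixP => -[].
rewrite !rowsS => -[v0 /IHk vw]; apply/row_matrixP => i.
case: (unliftP 0 i) => [j|] -> //.
by move/(congr1 (row j)): vw => /rowP vw; apply/rowP => l; have := vw l; rewrite !mxE.
Qed.

Lemma col_mx_row0 (K : Type) n k (v : 'M[K]_(k.+1, n)) :
  v = col_mx (row 0 v) (row' 0 v) :> 'M_(1 + k, n).
Proof. by apply: rows_inj; rewrite rows_col_mx [LHS]rowsS. Qed.

Lemma rows_perm_eq (K : eqType) n k (v : 'M[K]_(k, n)) s :
  perm_eq (rows v) s -> exists t : 'S_k, rows (row_perm t v) = s.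
Proof.
have mkE (F : 'I_k -> 'rV[K]_n) : [tuple F i | i < k] = map F (enum 'I_k) :> seq _.
  by rewrite /= -val_ord_tuple.
rewrite perm_sym => pvs; have : perm_eq s [tuple row i v | i < k] by rewrite mkE.
case/tuple_permP => t; rewrite mkE => ->; exists t; apply: eq_map => i.
by rewrite tnth_mktuple; apply/rowP => j; rewrite !mxE.
Qed.

Section BasisReduction.
Variables (R : realType) (n q : nat).
Variable H : kform R n R q.+1.

(** For antisymmetric functions, linearity in the first row implies it in all
    rows. *)
Definition linear_row0 : Prop := forall (a b : R) u w (r : 'M[Cplx R]_(q, n)),
  H (col_mx (ofreal a *: u + ofreal b *: w) r : 'M_(1 + q, n)) =
  a * H (col_mx u r : 'M_(1 + q, n)) + b * H (col_mx w r : 'M_(1 + q, n)).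

Hypotheses (HA : antisymmetric_fun H) (HL : linear_row0).

Lemma antisymmetric_eq0 (i j : 'I_q.+1) v :
  i != j -> row i v = row j v -> H v = 0.
Proof.
move=> ij vij; have := HA (tperm i j) v; rewrite odd_tperm ij expr1 mulN1r.
have -> : row_perm (tperm i j) v = v.
  apply/row_matrixP => k; rewrite row_permE; apply/rowP => l.
  rewrite !mxE; move/rowP: vij => /(_ l); rewrite !mxE => vij.
  rewrite (bigD1 (tperm i j k)) //= big1 ?addr0; last first.
    by move=> k' kk'; rewrite !mxE eq_sym (negbTE kk') mul0r.
  by rewrite !mxE eqxx mul1r; case: tpermP => // ->.
by move=> /eqP; rewrite -addr_eq0 -mulr2n mulrn_eq0 => /eqP.
Qed.

Lemma linear_row0_sum (I : Type) (s : seq I) (c : I -> R) u r :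
  H (col_mx (\sum_(i <- s) ofreal (c i) *: u i) r : 'M_(1 + q, n)) =
  \sum_(i <- s) c i * H (col_mx (u i) r : 'M_(1 + q, n)).
Proof.
elim: s => [|i s IHs].
  rewrite !big_nil; have := HL 0 0 0 0 r.
  by rewrite scaler0 addr0 !mul0r addr0.
rewrite !big_cons; have := HL (c i) 1 (u i) (\sum_(i <- s) ofreal (c i) *: u i) r.
by rewrite ofreal1 scale1r => ->; rewrite IHs mul1r.
Qed.

(** By multilinearity all the rows may be taken in the basis, then distinct
    because a repeated row gives 0; a permutation, which only changes the sign,
    puts the elements satisfying [K] first. *)
Lemma basis_reduction (B : finType) (e : B -> 'rV[Cplx R]_n) (K : pred B) :
    (forall u, exists c : B -> R, u = \sum_b ofreal (c b) *: e b) ->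
    (forall s1 s2 v, uniq (s1 ++ s2) -> all K s1 -> all (predC K) s2 ->
       rows v = map e (s1 ++ s2) -> H v = 0) ->
  forall v, H v = 0.
Proof.
move=> span H0.
have Hs s v : uniq s -> rows v = map e s -> H v = 0.
  move=> us vs; have ps : perm_eq s (seq.filter K s ++ seq.filter (predC K) s).
    by rewrite perm_sym; exact/permPl/perm_filterC.
  have : perm_eq (rows v) (map e (seq.filter K s ++ seq.filter (predC K) s)).
    by rewrite vs; exact: perm_map.
  move=> /rows_perm_eq[t vt]; have := HA t v; rewrite (H0 _ _ _ _ _ _ vt).
  - by move/esym/eqP; rewrite mulf_eq0 signr_eq0 => /eqP.
  - by rewrite -(perm_uniq ps).
  - exact: filter_all.
  - exact: filter_all.
have Hb (b : 'I_q.+1 -> B) v : (forall i, row i v = e (b i)) -> H v = 0.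
  move=> vb; have [binj|] := boolP (injectiveb b).
    apply: (Hs (map b (enum 'I_q.+1))).
      by rewrite map_inj_uniq ?enum_uniq//; exact/injectiveP.
    by rewrite -map_comp; apply: eq_map => i /=.
  move=> /injectivePn[i [j ij bij]].
  by apply: (antisymmetric_eq0 ij); rewrite !vb bij.
(* Induction on the number [p] of leading rows that may lie outside the basis. *)
have Hp p : (p <= q.+1)%N -> forall v,
    (forall i : 'I_q.+1, (p <= i)%N -> exists b, row i v = e b) -> H v = 0.
  elim: p => [_ v vb|p IHp pq v vb].
    by apply: (Hb (fun i => projT1 (cid (vb i isT)))) => i; case: cid.
  have [c vc] := span (row (Ordinal pq) v).
  pose t : 'S_q.+1 := tperm 0 (Ordinal pq).
  suff : H (row_perm t v) = 0.
    by rewrite HA => /eqP; rewrite mulf_eq0 signr_eq0 => /eqP.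
  rewrite (col_mx_row0 (row_perm t v)).
  have -> : row 0 (row_perm t v) = row (Ordinal pq) v.
    by apply/rowP => j; rewrite !mxE /t tpermL.
  rewrite vc linear_row0_sum big1// => b _.
  set w := col_mx _ _.
  suff : H (row_perm t w) = 0.
    move=> Hw; have := HA t w; rewrite Hw => /esym/eqP.
    by rewrite mulf_eq0 signr_eq0 /= => /eqP ->; rewrite mulr0.
  apply: (IHp (ltnW pq)) => i; rewrite leq_eqVlt => /orP[/eqP pi|pi].
    exists b; have -> : i = Ordinal pq by exact/val_inj/esym.
    apply/rowP => j; rewrite 2!mxE /t tpermR /w.
    by rewrite col_mx_unlift unlift_none.
  have [b' vb'] := vb i pi; exists b'; rewrite -vb'.
  have ti : t i = i.
    by rewrite /t tpermD// -val_eqE/=; lia.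
  apply/rowP => j; rewrite 2!mxE ti [RHS]mxE.
  have i0 : 0 != i by rewrite -val_eqE /=; lia.
  case: (unliftP 0 i) i0 => [i' iE _|->]; last by rewrite eqxx.
  by rewrite /w col_mx_unlift {1}iE liftK 2!mxE -iE ti.
by move=> v; apply: (Hp q.+1) => // i; rewrite leqNgt ltn_ord.
Qed.

End BasisReduction.

(** * The twisted differential of a power of a 2-form *)

Lemma rows_surj (K : nmodType) n k (s : seq 'rV[K]_n) :
  size s = k -> exists v : 'M[K]_(k, n), rows v = s.
Proof.
elim: k s => [|k IHk] [|u s] //=.
  by exists (\matrix_(i < 0) 0); apply: size0nil; rewrite size_rows.
by move=> [/IHk[v <-]]; exists (col_mx u v : 'M_(1 + k, n)); exact: rows_col_mx.
Qed.

Section RealLinear.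
Variables (R : realType) (n : nat).

Definition rlinear (f : 'rV[Cplx R]_n -> R) : Prop := forall (c d : R) u v,
  f (ofreal c *: u + ofreal d *: v) = c * f u + d * f v.

Lemma rlinear0 f : rlinear f -> f 0 = 0.
Proof. by move=> /(_ 0 0 0 0); rewrite !scaler0 addr0 !mul0r addr0. Qed.

Lemma rlinear_sum f (I : Type) (s : seq I) u :
  rlinear f -> f (\sum_(i <- s) u i) = \sum_(i <- s) f (u i).
Proof.
move=> fl; elim: s => [|i s IHs]; first by rewrite !big_nil rlinear0.
rewrite !big_cons; have := fl 1 1 (u i) (\sum_(i <- s) u i).
by rewrite ofreal1 !scale1r !mul1r IHs.
Qed.

Lemma alternating_form1 (a : kform R n R 1) : alternating_form a -> rlinear a.
Proof.
move=> [al _] c d u v; apply: (al 0); first by apply/rowP => j; rewrite !mxE.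
all: by apply/matrixP => -[].
Qed.

Let pair_mx (u w : 'rV[Cplx R]_n) : 'M[Cplx R]_(2, n) := col_mx u w : 'M_(1 + 1, n).

Let pair_mxE u w : [/\ row 0 (pair_mx u w) = u, row 1 (pair_mx u w) = w,
  row' 0 (pair_mx u w) = w & row' 1 (pair_mx u w) = u].
Proof.
have l1 : 1 = lift 0 0 :> 'I_2 by exact: val_inj.
split; apply/matrixP => i j; rewrite mxE /pair_mx col_mx_unlift ?ord1.
- by rewrite unlift_none.
- by rewrite l1 liftK.
- by rewrite liftK.
- by rewrite (_ : lift 1 0 = 0) ?unlift_none//; exact: val_inj.
Qed.

Lemma alternating_form2l (a : kform R n R 2) w :
  alternating_form a -> rlinear (fun u => form2 a u w).
Proof.
move=> [al _] c d u v; apply: (al 0 c d (pair_mx _ w) (pair_mx u w) (pair_mx v w)).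
- by have [-> _ _ _] := pair_mxE u w; have [-> _ _ _] := pair_mxE v w;
    have [-> _ _ _] := pair_mxE (ofreal c *: u + ofreal d *: v) w.
- by have [_ _ -> _] := pair_mxE u w;
    have [_ _ -> _] := pair_mxE (ofreal c *: u + ofreal d *: v) w.
- by have [_ _ -> _] := pair_mxE v w;
    have [_ _ -> _] := pair_mxE (ofreal c *: u + ofreal d *: v) w.
Qed.

Lemma alternating_form2r (a : kform R n R 2) w :
  alternating_form a -> rlinear (form2 a w).
Proof.
move=> [al _] c d u v; apply: (al 1 c d (pair_mx w _) (pair_mx w u) (pair_mx w v)).
- by have [_ -> _ _] := pair_mxE w u; have [_ -> _ _] := pair_mxE w v;
    have [_ -> _ _] := pair_mxE w (ofreal c *: u + ofreal d *: v).
- by have [_ _ _ ->] := pair_mxE w u;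
    have [_ _ _ ->] := pair_mxE w (ofreal c *: u + ofreal d *: v).
- by have [_ _ _ ->] := pair_mxE w v;
    have [_ _ _ ->] := pair_mxE w (ofreal c *: u + ofreal d *: v).
Qed.

End RealLinear.

Section TwistedDifferential.
Variables (R : realType) (n : nat).
Implicit Types (x u v : 'rV[Cplx R]_n) (U : set 'rV[Cplx R]_n).

Lemma class_C1_altsum U (g : 'rV[Cplx R]_n -> 'rV[Cplx R]_n ->
    seq 'rV[Cplx R]_n -> R) s : open U ->
  (forall u r, class_C 1 U (fun y => g y u r)) ->
  class_C 1 U (fun y => altsum (g y) s).
Proof.
move=> oU; elim: s g => [|u s IHs] g Cg; first exact: (class_C_cst 1 U 0).
apply: (class_CD oU (Cg u s)).
have CN := IHs (fun y w r => g y w (u :: r)) (fun w r => Cg w _).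
apply: class_C_ext (class_C1M oU (class_C_cst 1 U (-1)) CN) => // y _.
by rewrite mulN1r.
Qed.

Lemma class_C1_pfaff U (b : 'rV[Cplx R]_n -> 'rV[Cplx R]_n -> 'rV[Cplx R]_n -> R) s :
    open U -> (forall u v, class_C 1 U (fun y => b y u v)) ->
  class_C 1 U (fun y => pfaff (b y) s).
Proof.
move=> oU Cb; rewrite /pfaff; move: (size s)./2 => k.
elim: k s => [|k IHk] s; first exact: (class_C_cst 1 U (nilp s)%:R).
apply: (class_C1M oU (class_C_cst 1 U (size s)%:R^-1)).
apply: (class_C1_altsum _ oU) => u r; apply: (class_C1_altsum _ oU) => w r'.
exact: (class_C1M oU (Cb _ _) (IHk _)).
Qed.

(** The operator f |-> df (u) - theta (u) f at the point [x], applied to the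
    Pfaffian of [s]. *)
Definition twisted_term x (th : 'rV[Cplx R]_n -> R)
    (b : 'rV[Cplx R]_n -> 'rV[Cplx R]_n -> 'rV[Cplx R]_n -> R) u s : R :=
  rderive u (fun y => pfaff (b y) s) x - th u * pfaff (b x) s.

Definition twisted_d x th b s : R := altsum (twisted_term x th b) s.

Lemma is_rderiveMl x u (c : R) (f : 'rV[Cplx R]_n -> R) :
  rderivable u f x -> rderive u (fun y => c * f y) x = c * rderive u f x.
Proof.
move=> /rderivableP df.
have := is_rderiveP (is_rderiveM (is_rderive_cst x u c) df).
by rewrite mul0r add0r => -[].
Qed.

(** Both the exterior differential and the wedge product with a 1-form are
    alternating sums over the argument that is removed. *)
Lemma ext_d_sub_wedge U x (w : 'rV[Cplx R]_n -> kform R n R 2)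
    (th : kform R n R 1) k (v : 'M_(k.*2.+1, n)) :
    open U -> U x -> (forall p : 'M_(2, n), class_C 1 U (fun y => w y p)) ->
  ext_d (fun y => wedge_exp (w y) k) x v - wedge th (wedge_exp (w x) k) v =
  k`!%:R * twisted_d x th (fun y => form2 (w y)) (rows v).
Proof.
move=> oU Ux Cw; rewrite wedge_1l; last exact: wedge_exp_antisymmetric.
rewrite -altsumMl -(@row_altsumE _ _ _ _ (fun u r =>
  rderive u (fun y => wedge_exp (w y) k r) x - th u * wedge_exp (w x) k r)).
  rewrite /row_altsum -sumrB; apply: eq_bigr => i _; exact: esym (mulrBr _ _ _).
move=> u r; rewrite wedge_exp_pfaff /twisted_term mulrBr mulrCA; congr (_ - _).
rewrite -is_rderiveMl.
  by congr rderive; apply/funext => y; rewrite wedge_exp_pfaff.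
apply: class_C1_rderivable Ux; apply: class_C1_pfaff => // u' v'; exact: Cw.
Qed.

End TwistedDifferential.

(** * Sums of pullbacks to a product of open sets *)

Section MatrixTopology.
Variable R : realType.

Lemma cvg_mx (T : Type) (F : set_system T) (FF : Filter F) (p q : nat)
    (f : T -> 'M[Cplx R]_(p, q)) (M : 'M[Cplx R]_(p, q)) :
  (forall i j, (fun t => f t i j) @ F --> M i j) -> f @ F --> M.
Proof.
move=> fM A [P PM sPA].
have : \forall t \near F, forall i j, P i j (f t i j).
  by apply: filter_forall => i; apply: filter_forall => j; exact: fM.
by apply: filterS => t Pt; apply: sPA.
Qed.

Lemma colsub_continuous (p q r : nat) (h : 'I_q -> 'I_r) :
  continuous (colsub h : 'M[Cplx R]_(p, r) -> 'M[Cplx R]_(p, q)).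
Proof.
move=> M; apply: (@cvg_mx _ (nbhs M) (nbhs_filter M)) => i j; rewrite mxE.
rewrite (_ : (fun t => _) = fun N : 'M[Cplx R]_(p, r) => N i (h j)).
  exact: coord_continuous.
by apply/funext => N; rewrite mxE.
Qed.

End MatrixTopology.

Section LocalProduct.
Variables (R : realType) (m : nat) (n : 'I_m -> nat).
Local Notation N := (\sum_(i < m) n i)%N.
Local Notation V := 'rV[Cplx R]_N.

Definition block_proj (i : 'I_m) (y : V) : 'rV[Cplx R]_(n i) := submxrow y i.

Lemma block_proj_linear i : linear (block_proj i).
Proof. by move=> a u v; apply/rowP => j; rewrite !mxE. Qed.

Lemma block_proj_continuous i : continuous (block_proj i).
Proof. exact: colsub_continuous. Qed.

Lemma block_projDZ i a b u v :
  block_proj i (a *: u + b *: v) = a *: block_proj i u + b *: block_proj i v.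
Proof. by apply/rowP => j; rewrite !mxE. Qed.

Definition sum_form k (a : forall i, 'rV[Cplx R]_(n i) -> kform R (n i) R k) :
    V -> kform R N R k :=
  fun y v => \sum_i a i (block_proj i y) (submxrow v i).

Definition block_preimage (U : forall i, set 'rV[Cplx R]_(n i)) : set V :=
  [set y | forall i, U i (block_proj i y)].

Lemma open_block_preimage U : (forall i, open (U i)) -> open (block_preimage U).
Proof.
move=> oU; rewrite openE => y Uy.
apply: (@filter_forall _ _ (fun i => [set z | U i (block_proj i z)]) (nbhs y)) => i.
apply: (@block_proj_continuous i y (U i)); apply: open_nbhs_nbhs.
split; first exact: oU.
exact: Uy.
Qed.

Lemma class_C_sum_form l k U (a : forall i, 'rV[Cplx R]_(n i) -> kform R (n i) R k) :
    (forall i, open (U i)) ->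
    (forall i v, class_C l (U i) (fun y => a i y v)) ->
  forall v, class_C l (block_preimage U) (fun y => sum_form a y v).
Proof.
move=> oU Ca v; apply: class_C_sum; first exact: open_block_preimage.
move=> i.
apply: (class_C_comp (@block_proj_linear i) (@block_proj_continuous i)) (Ca i _).
  exact: open_block_preimage.
by move=> y; exact.
Qed.

Lemma row_submxrow k (v : 'M[Cplx R]_(k, N)) i (j : 'I_k) :
  row j (submxrow v i) = block_proj i (row j v).
Proof. by apply/rowP => l; rewrite !mxE. Qed.

Lemma alternating_sum_form k (a : forall i, 'rV[Cplx R]_(n i) -> kform R (n i) R k) y :
    (forall i, alternating_form (a i (block_proj i y))) ->
  alternating_form (sum_form a y).
Proof.
move=> aA; split=> [j b c u v w uE vu wu|j j' v jj' vE]; last first.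
  rewrite /sum_form big1// => i _; apply: (aA i).2 jj' _.
  by rewrite !row_submxrow vE.
rewrite /sum_form !big_distrr -big_split; apply: eq_bigr => i _.
apply: ((aA i).1 j); first by rewrite !row_submxrow uE block_projDZ.
  apply/matrixP => p q; move/matrixP: vu => /(_ p (tagnat.Rank i q)).
  by rewrite !mxE => ->.
apply/matrixP => p q; move/matrixP: wu => /(_ p (tagnat.Rank i q)).
by rewrite !mxE => ->.
Qed.

Lemma form2_sum_form (a : forall i, 'rV[Cplx R]_(n i) -> kform R (n i) R 2) y u v :
  form2 (sum_form a y) u v =
  \sum_i form2 (a i (block_proj i y)) (block_proj i u) (block_proj i v).
Proof.
apply: eq_bigr => i _; congr a; apply/matrixP => j l.
by rewrite mxE !col_mx_unlift; case: unlift => [?|]; rewrite mxE.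
Qed.

(** The component of [u] in the factor [i], kept in the big space. *)
Definition block_part (i : 'I_m) (u : V) : V :=
  \row_k (if tagnat.sig1 k == i then u 0 k else 0).

Lemma block_part_linear i a b u v :
  block_part i (a *: u + b *: v) = a *: block_part i u + b *: block_part i v.
Proof.
by apply/rowP => k; rewrite !mxE; case: ifP => // _; rewrite !mulr0 addr0.
Qed.

Lemma sum_block_part u : \sum_i block_part i u = u.
Proof.
apply/rowP => k; rewrite summxE (bigD1 (tagnat.sig1 k)) //= mxE eqxx.
rewrite [X in _ + X]big1 ?addr0// => i ik.
by rewrite mxE eq_sym (negbTE ik).
Qed.

(** The vectors e_j and i e_j, a basis over the real numbers in which every
    vector lies in a single factor. *)
Definition real_basis (b : 'I_N * bool) : V :=
  (if b.2 then 'i%C else 1) *: delta_mx 0 b.1.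

Lemma real_basis_span u : exists c : 'I_N * bool -> R,
  u = \sum_b ofreal (c b) *: real_basis b.
Proof.
exists (fun b => if b.2 then complex.Im (u 0 b.1) else complex.Re (u 0 b.1)).
rewrite -(pair_big predT predT (fun j (b : bool) => ofreal (if b then complex.Im (u 0 j)
  else complex.Re (u 0 j)) *: real_basis (j, b))) /=.
rewrite [LHS]row_sum_delta; apply: eq_bigr => j _.
rewrite big_bool /real_basis /= !scalerA -scalerDl mulr1; congr (_ *: _).
by rewrite [LHS]complexE addrC mulrC.
Qed.

Definition in_block (i : 'I_m) (b : 'I_N * bool) : bool := tagnat.sig1 b.1 == i.

Lemma block_part_basis i b :
  block_part i (real_basis b) = if in_block i b then real_basis b else 0.
Proof.
rewrite /in_block; case: ifP => bi; apply/rowP => k; rewrite !mxE.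
all: have [->|kb] := eqVneq k b.1; rewrite ?bi ?mulr0//.
by case: ifP.
by case: ifP.
Qed.

Lemma block_proj_basis i b : ~~ in_block i b -> block_proj i (real_basis b) = 0.
Proof.
move=> bi; apply/rowP => k; rewrite !mxE eqxx /=.
have [kb|_] := eqVneq; last by rewrite mulr0.
by move: bi; rewrite /in_block -kb tagnat.Rank1K eqxx.
Qed.

Lemma card_in_block i : #|in_block i| = (n i).*2.
Proof.
pose h (kb : 'I_(n i) * bool) := (@tagnat.Rank m n i kb.1, kb.2).
have h_inj : injective h.
  move=> [k b] [k' b'] E; congr (_, _); last by case: E.
  have /eqP := congr1 (fun z : 'I_N * bool => nat_of_ord z.1) E.
  by rewrite /= tagnat.eq_Rank eqxx => /eqP/val_inj.
rewrite -muln2 -card_bool -[X in (X * _)%N]card_ord -card_prod -(card_codom h_inj).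
apply: eq_card => -[j b]; apply/idP/codomP => [/eqP /= ji|[[k b'] [-> _]]].
  clear h_inj; rewrite {}/h; case: _ / ji.
  by exists (tagnat.sig2 j, b); rewrite /= tagnat.sig2K.
by rewrite unfold_in /in_block /= tagnat.Rank1K.
Qed.

End LocalProduct.

(** * The twisted differential on a product *)

Section LocalProductIdentity.
Variables (R : realType) (m : nat) (n : 'I_m -> nat).
Local Notation N := (\sum_(i < m) n i)%N.
Local Notation V := 'rV[Cplx R]_N.
Variables (U : forall i, set 'rV[Cplx R]_(n i)).
Variables (w : forall i, 'rV[Cplx R]_(n i) -> kform R (n i) R 2).
Variables (th : forall i, 'rV[Cplx R]_(n i) -> kform R (n i) R 1).
Arguments U : clear implicits.
Arguments w : clear implicits.
Arguments th : clear implicits.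
Hypothesis n_gt0 : forall i, (0 < n i)%N.
Hypothesis oU : forall i, open (U i).
Hypothesis wC : forall i v, class_C 1 (U i) (fun y => w i y v).
Hypothesis wA : forall i y, U i y -> alternating_form (w i y).
Hypothesis thA : forall i y, U i y -> alternating_form (th i y).
Hypothesis LCB : forall i y, U i y ->
  ext_d (fun y => wedge_exp (w i y) (n i).-1) y =
  wedge (th i y) (wedge_exp (w i y) (n i).-1).

Local Notation e := (@real_basis R m n).
Let PU := block_preimage U.
Let W := sum_form w.
Let TH := sum_form th.
Let b (y : V) := form2 (W y).

Let oPU : open PU. Proof. exact: open_block_preimage. Qed.

Let W_alt y : PU y -> alternating_form (W y).
Proof. by move=> Uy; apply: alternating_sum_form => i; exact: wA. Qed.

Let W_C1 v : class_C 1 PU (fun y => W y v).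
Proof. by apply: class_C_sum_form. Qed.

Let pf_C1 s : class_C 1 PU (fun y => pfaff (b y) s).
Proof. by apply: (class_C1_pfaff _ oPU) => u v; exact: W_C1. Qed.

Section AtPoint.
Variable x : V.
Hypothesis Ux : PU x.

Let pf_deriv s u : rderivable u (fun y => pfaff (b y) s) x.
Proof. exact: class_C1_rderivable (pf_C1 s) Ux. Qed.

Let TH_linear : rlinear (TH x).
Proof.
by apply: alternating_form1; apply: alternating_sum_form => i; exact: thA.
Qed.

Let term := twisted_term x (TH x) b.

Lemma twisted_term_linear s : rlinear (term^~ s).
Proof.
move=> c d u v; rewrite /term /twisted_term (class_C1_linear _ _ _ _ oPU Ux (pf_C1 s)).
by rewrite TH_linear !mulrBr mulrDl !mulrA opprD addrACA.
Qed.

(** The part of the twisted differential along the factor [i]: derivatives are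
    taken in the directions of this factor only. *)
Definition block_twisted_d i s := altsum (fun u r => term (block_part i u) r) s.

Lemma twisted_d_blocks s : twisted_d x (TH x) b s = \sum_i block_twisted_d i s.
Proof.
rewrite /twisted_d /block_twisted_d; transitivity (altsum (fun u r =>
    \sum_i term (block_part i u) r) s).
  apply: eq_altsum => u r _.
  by rewrite -(rlinear_sum _ _ (twisted_term_linear r)) sum_block_part.
exact: altsum_sum.
Qed.

(** Seen through wedge powers, which are antisymmetric by construction. *)
Lemma pfaff_antisymmetric y k :
  antisymmetric_fun (fun r : 'M[Cplx R]_(k.*2, N) => pfaff (b y) (rows r)).
Proof.
move=> t v; apply: (mulfI (fact_neq0 R k)).
by rewrite mulrCA -!wedge_exp_pfaff wedge_exp_antisymmetric.
Qed.

Lemma block_twisted_d_antisymmetric i k :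
  antisymmetric_fun (fun v : 'M[Cplx R]_(k.*2.+1, N) => block_twisted_d i (rows v)).
Proof.
pose g (u : V) (r : 'M[Cplx R]_(k.*2, N)) := term (block_part i u) (rows r).
have gA u : antisymmetric_fun (g u).
  move=> t r; rewrite /g /term /twisted_term pfaff_antisymmetric mulrCA mulrBr.
  congr (_ - _); rewrite -is_rderiveMl; last exact: pf_deriv.
  by congr (rderive _ _ x); apply/funext => y; rewrite pfaff_antisymmetric.
have E v : block_twisted_d i (rows v) = (k.*2)`!%:R^-1 *
    antisymmetrize (fun u => g (row 0 u) (row' 0 u)) v.
  rewrite -row_altsum_antisymmetrize// mulKf ?fact_neq0//.
  by apply/esym; apply: row_altsumE.
by move=> t v; rewrite !E antisymmetrize_antisymmetric mulrCA.
Qed.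

Lemma pfaff_head_linear y s : PU y -> rlinear (fun u => pfaff (b y) (u :: s)).
Proof.
move=> Uy c d u v; apply: pfaff_linear_head => z.
  exact: (alternating_form2l z (W_alt Uy)).
exact: (alternating_form2r z (W_alt Uy)).
Qed.

(** The first row is either the direction of differentiation, or the first
    argument of a Pfaffian, which depends linearly on it at every point near
    [x]. *)
Lemma block_twisted_d_linear_row0 i k :
  linear_row0 (fun v : 'M[Cplx R]_(k.*2.+1, N) => block_twisted_d i (rows v)).
Proof.
move=> c d u v r; rewrite !rows_col_mx /block_twisted_d /=.
rewrite block_part_linear twisted_term_linear.
move: (term (block_part i u) (rows r)) (term (block_part i v) (rows r)) => tu tv.
rewrite !mulrBr addrACA -opprD; congr (_ - _).
rewrite -!altsumMl -altsumD; apply: eq_altsum => z s _.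
rewrite /term /twisted_term (pfaff_head_linear _ Ux).
set D := rderive _ _ _.
have -> : D = c * rderive (block_part i z) (fun y => pfaff (b y) (u :: s)) x +
    d * rderive (block_part i z) (fun y => pfaff (b y) (v :: s)) x.
  have E : {in PU, (fun y => c * pfaff (b y) (u :: s) + d * pfaff (b y) (v :: s)) =1
      (fun y => pfaff (b y) (ofreal c *: u + ofreal d *: v :: s))}.
    by move=> y; rewrite inE => Uy; rewrite (pfaff_head_linear _ Uy).
  have DM a z' := is_rderiveM (is_rderive_cst x (block_part i z) a)
     (rderivableP (@pf_deriv (z' :: s) (block_part i z))).
  have [D1 D2] := is_rderiveP (is_rderiveD (DM c u) (DM d v)).
  rewrite /D (near_rderive oPU Ux E D1).2 D2.
  by rewrite !mul0r !add0r.
by rewrite !mulrBr mulrDr !(mulrCA (TH _ _)) opprD addrACA.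
Qed.

(** The identity assumed on the factor [i], read on lists of vectors. *)
Lemma factor_twisted_d i s : size s = (n i).-1.*2.+1 ->
  twisted_d (block_proj i x) (th i (block_proj i x)) (fun y => form2 (w i y)) s = 0.
Proof.
move=> ss; have [v <-] := rows_surj ss.
apply: (mulfI (fact_neq0 R (n i).-1)); rewrite mulr0.
by rewrite -(ext_d_sub_wedge _ _ (@oU i) (Ux i) (@wC i)) LCB ?subrr.
Qed.

Lemma form2_basis i c c' y : PU y -> in_block i c ->
  form2 (W y) (e c) (e c') =
  form2 (w i (block_proj i y)) (block_proj i (e c)) (block_proj i (e c')).
Proof.
move=> Uy ci; rewrite form2_sum_form (bigD1 i) //= [X in _ + X]big1 ?addr0// => j ji.
rewrite (block_proj_basis R (i := j)) ?(rlinear0 (alternating_form2l _ (wA _)))//.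
by move: ci; rewrite /in_block => /eqP ->; rewrite eq_sym.
Qed.

Lemma form2_basis_r i c c' y : PU y -> in_block i c ->
  form2 (W y) (e c') (e c) =
  form2 (w i (block_proj i y)) (block_proj i (e c')) (block_proj i (e c)).
Proof.
move=> Uy ci; rewrite form2_sum_form (bigD1 i) //= [X in _ + X]big1 ?addr0// => j ji.
rewrite (block_proj_basis R (b := c)) ?(rlinear0 (alternating_form2r _ (wA _)))//.
by move: ci; rewrite /in_block => /eqP ->; rewrite eq_sym.
Qed.

(** The factors are orthogonal for the sum of the forms, and on the factor [i]
    this sum is the form number [i]. *)
Lemma pfaff_basis_cat i s1 s2 y : PU y ->
    all (in_block i) s1 -> all (predC (in_block i)) s2 ->
  pfaff (b y) (map e (s1 ++ s2)) =
  pfaff (form2 (w i (block_proj i y))) (map (@block_proj R m n i) (map e s1)) *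
  pfaff (b y) (map e s2).
Proof.
move=> Uy /allP s1i /allP s2i; rewrite map_cat pfaff_cat; last first.
  move=> _ _ /mapP[c /s1i ci ->] /mapP[c' /s2i ci' ->].
  rewrite /b (form2_basis _ Uy ci) (form2_basis_r _ Uy ci) (block_proj_basis R ci').
  by split; [apply: (rlinear0 (alternating_form2r _ (wA _)))
           |apply: (rlinear0 (alternating_form2l _ (wA _)))].
rewrite -map_comp !pfaff_map; congr (_ * _); apply: eq_pfaff => c c' /s1i ci _ /=.
exact: form2_basis.
Qed.

(** Moving in the factor [i] does not change the base points in the other
    factors, and only these enter the Pfaffian of vectors of the other factors.
    This replaces the closedness of top degree forms. *)
Lemma is_rderive_pfaff_other i c s : in_block i c -> all (predC (in_block i)) s ->
  is_rderive x (e c) (fun y => pfaff (b y) (map e s)) 0.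
Proof.
move=> ci /allP si.
have : is_derive (0 : R) (1 : R) (cst (pfaff (b x) (map e s))) 0.
  exact: is_derive_cst.
apply: near_eq_is_derive; near=> t.
have Ut : PU (x + ofreal t *: e c) by near: t; exact: near_ray.
rewrite /line /cst /= !pfaff_map; apply: eq_pfaff => c1 c2 /si c1i /si c2i.
rewrite /b !form2_sum_form; apply: eq_bigr => j _.
have [ji|ji] := eqVneq j i.
  subst j; rewrite (block_proj_basis R c1i).
  by rewrite !(rlinear0 (alternating_form2l _ (wA _))).
congr form2; congr w; rewrite -[x in block_proj j (x + _)]scale1r block_projDZ scale1r.
rewrite (block_proj_basis R (b := c)) ?scaler0 ?addr0//.
by move: ci; rewrite /in_block => /eqP ->; rewrite eq_sym.
Unshelve. all: by end_near. Qed.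

(** The directions in the second list have no component along [i]; for those of
    the first list, the Pfaffian of the second one is constant and factors
    out. *)
Lemma block_twisted_d_cat i s1 s2 :
    all (in_block i) s1 -> all (predC (in_block i)) s2 ->
  block_twisted_d i (map e (s1 ++ s2)) =
  twisted_d (block_proj i x) (th i (block_proj i x)) (fun y => form2 (w i y))
    (map (@block_proj R m n i) (map e s1)) * pfaff (b x) (map e s2).
Proof.
move=> s1i s2i; rewrite /block_twisted_d map_cat altsum_cat.
rewrite [X in _ * X]altsum_map [X in _ * X]altsum_eq0 ?mulr0 ?addr0; last first.
  move=> c r /perm_mem pcr; rewrite block_part_basis ifN; last first.
    by apply: (allP s2i); rewrite -pcr mem_head.
  rewrite /term /twisted_term (rlinear0 TH_linear) mul0r subr0.
  exact: (is_rderiveP (is_rderive_dir0 _ _)).2.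
rewrite /twisted_d -altsumMr !altsum_map; apply: eq_altsum => c r pcr.
have /andP[ci ri] : all (in_block i) (c :: r) by rewrite (perm_all _ pcr).
rewrite -map_cat block_part_basis ci /term /twisted_term.
rewrite (pfaff_basis_cat Ux ri s2i) mulrBl mulrA; congr (_ - _ * _ * _); last first.
  rewrite /TH /sum_form (bigD1 i) //= [X in _ + X]big1 ?addr0 => [|j ji].
    by congr th; apply/matrixP => k l; rewrite !mxE ord1.
  have -> : submxrow (e c) j = 0.
    apply: (block_proj_basis R (i := j)); move: ci; rewrite /in_block => /eqP ->.
    by rewrite eq_sym.
  exact: (rlinear0 (alternating_form1 (thA _))).
pose F y := pfaff (form2 (w i y)) (map (@block_proj R m n i) (map e r)).
have dF : rderivable (block_proj i (e c)) F (block_proj i x).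
  apply: class_C1_rderivable (Ux i).
  by apply: (class_C1_pfaff _ (@oU i)) => u v; exact: wC.
have E : {in PU, (fun y => (F \o @block_proj R m n i) y * pfaff (b y) (map e s2)) =1
    (fun y => pfaff (b y) (map e (r ++ s2)))}.
  by move=> y; rewrite inE => Uy; rewrite (pfaff_basis_cat Uy ri s2i).
(* The factor for the second list has derivative 0 along [e c]. *)
have D := is_rderiveM (is_rderive_comp (@block_proj_linear R m n i) (rderivableP dF))
  (is_rderive_pfaff_other ci s2i).
by rewrite (is_rderiveP (near_is_rderive oPU Ux E D)).2 mulr0 addr0.
Qed.

(** Among 2N - 1 distinct basis vectors only one is missing, from the factor [i]
    or from the others. *)
Lemma block_twisted_d_basis i s1 s2 : uniq (s1 ++ s2) ->
    all (in_block i) s1 -> all (predC (in_block i)) s2 ->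
    size (s1 ++ s2) = N.-1.*2.+1 ->
  block_twisted_d i (map e (s1 ++ s2)) = 0.
Proof.
move=> us s1i s2i; rewrite size_cat => ss.
rewrite block_twisted_d_cat//.
have le1 : (size s1 <= (n i).*2)%N.
  move: us; rewrite cat_uniq => /and3P[us1 _ _].
  rewrite -card_in_block -(card_uniqP us1); apply: subset_leq_card.
  by apply/fintype.subsetP => c /(allP s1i).
have le2 : (size s2 <= (N - n i).*2)%N.
  move: us; rewrite cat_uniq => /and3P[_ _ us2].
  rewrite doubleB -card_in_block -(card_uniqP us2).
  have -> : N.*2 = #|{: 'I_N * bool}| by rewrite card_prod card_ord card_bool muln2.
  rewrite -(cardC (in_block i)) addKn; apply: subset_leq_card.
  by apply/fintype.subsetP => c /(allP s2i).
have nN : (n i <= N)%N by rewrite (bigD1 i) //= leq_addr.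
(* If an even number of vectors lie outside the factor [i], the counts leave
   exactly 2 n_i - 1 of them inside. *)
have [os2|es2] := boolP (odd (size s2)).
  by rewrite [X in _ * X]pfaff_odd ?size_map ?mulr0.
rewrite factor_twisted_d ?mul0r// !size_map.
have arith (a c p q : nat) : (0 < p)%N -> (p <= q)%N -> (a <= p.*2)%N ->
    (c <= (q - p).*2)%N -> ~~ odd c -> (a + c = q.-1.*2.+1)%N -> a = p.-1.*2.+1.
  by lia.
exact: arith (n_gt0 i) nN le1 le2 es2 ss.
Qed.

Lemma block_twisted_d_eq0 i (v : 'M[Cplx R]_(N.-1.*2.+1, N)) :
  block_twisted_d i (rows v) = 0.
Proof.
apply: (@basis_reduction _ _ _ (fun v => block_twisted_d i (rows v))
  (block_twisted_d_antisymmetric i (k := N.-1)) (@block_twisted_d_linear_row0 i N.-1)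
  _ (e) (in_block i)); first exact: real_basis_span.
move=> s1 s2 {}v us s1i s2i vE; rewrite vE; apply: block_twisted_d_basis => //.
by rewrite -(size_map (e)) -vE size_rows.
Qed.

End AtPoint.

(** The local form of the theorem, in a product of charts. *)
Lemma sum_form_LCB x : PU x ->
  ext_d (fun y => wedge_exp (W y) N.-1) x = wedge (TH x) (wedge_exp (W x) N.-1).
Proof.
move=> Ux; apply/funext => v; apply/eqP; rewrite -subr_eq0.
rewrite (ext_d_sub_wedge _ _ oPU Ux W_C1) twisted_d_blocks//.
by rewrite [X in _ * X]big1 ?mulr0// => i _; exact: block_twisted_d_eq0.
Qed.

End LocalProductIdentity.

(** * Finite products of topological spaces *)

Section FiniteProductTopology.
Variables (I : finType) (K : I -> topologicalType).

(** The product topology is the coarsest for which the projections are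
    continuous. *)
Lemma cvg_prod_topology (F : set_system (prod_topology K)) (x : prod_topology K) :
  Filter F -> (forall i, (fun y : prod_topology K => y i) @ F --> x i) -> F --> x.
Proof.
move=> FF Fx; apply/cvg_sup => i A [V [[W oW WV] Vx] VA].
apply: (filterS VA); rewrite -WV; apply: Fx.
by apply: open_nbhs_nbhs; split => //; move: Vx; rewrite -WV.
Qed.

Lemma prod_topology_proj_continuous i :
  continuous (fun y : prod_topology K => y i).
Proof. exact: (@function_spaces.proj_continuous I K i). Qed.

Lemma nbhs_prod_topology (x : prod_topology K) (P : forall i, set (K i)) :
  (forall i, nbhs (x i) (P i)) -> nbhs x [set y | forall i, P i (y i)].
Proof.
move=> Px; apply: (@filter_forall _ _ (fun i => [set y | P i (y i)]) (nbhs x)) => i.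
exact: (prod_topology_proj_continuous (Px i)).
Qed.

(** Boxes form a filter, which converges to [x] because its projections do. *)
Lemma nbhs_prod_topology_box (x : prod_topology K) A : nbhs x A ->
  exists2 P : forall i, set (K i), forall i, nbhs (x i) (P i) &
    [set y | forall i, P i (y i)] `<=` A.
Proof.
pose F := filter_from [set P : forall i, set (K i) | forall i, nbhs (x i) (P i)]
  (fun P => [set y : prod_topology K | forall i, P i (y i)]).
have FF : Filter F.
  apply: filter_from_filter => [|P Q Px Qx].
    by exists (fun i => setT) => i; exact: filterT.
  exists (fun i => P i `&` Q i) => [i|y PQy]; first exact: filterI.
  by split=> i; case: (PQy i).
suff Fx : F --> x by move=> /Fx.
apply: cvg_prod_topology => i B Bx.
(* The box with side [B] in position [i] and full sides elsewhere. *)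
have ex (j : I) : exists C : set (K j), nbhs (x j) C /\
    forall e : i = j, C `<=` (ecast j (set (K j)) e B).
  have [ij|ij] := eqVneq i j; last first.
    by exists setT; split=> [|e]; [exact: filterT|rewrite e eqxx in ij].
  case: _ / ij; exists B; split => // e.
  by rewrite (eq_irrelevance e (erefl i)).
exists (fun j => projT1 (cid (ex j))) => [j|y Py].
  by case: cid => C [].
have := Py i; case: cid => C [_ /= CB] /(CB (erefl i)); exact.
Qed.

(** Boxes of basic open sets, indexed by the countable type of functions from a
    finite type to the natural numbers. *)
Lemma second_countable_prod_topology :
  (forall i, @second_countable (K i)) -> @second_countable (prod_topology K).
Proof.
move=> K2.
have [B BP] : exists B : forall i, set (set (K i)),
    forall i, countable (B i) /\ basis (B i).
  exists (fun i => projT1 (cid2 (K2 i))) => i.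
  by case: cid2.
have bE i : exists b : nat -> set (K i), forall U, B i U -> exists k, b k = U.
  have [cB _] := BP i; have /countable_injP[h hinj] := cB.
  exists (fun k => xget setT [set U | B i U /\ h U = k]) => U BU; exists (h U).
  case: xgetP => [V _ [BV /hinj]|/(_ U)]; last by case.
  by apply; exact/mem_set.
pose b i := projT1 (cid (bE i)).
have bP i U : B i U -> exists k, b i k = U.
  by move=> BU; rewrite /b; case: cid => /=; auto.
pose box (f : {ffun I -> nat}) : set (prod_topology K) :=
  [set y | forall i, b i (f i) (y i)].
exists [set box f | f in [set f : {ffun I -> nat} | forall i, B i (b i (f i))]].
  apply: (@card_le_trans _ _ _ [set: {ffun I -> nat}]); last exact: countableP.
  exact: (card_le_trans (card_image_le _ _) (subset_card_le _)).
split=> [_ [f Bf <-]|x].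
  rewrite openE => y yf; apply: (@nbhs_prod_topology y (fun i => b i (f i))) => i.
  have [_ [Bo _]] := BP i; apply: open_nbhs_nbhs; split; last exact: yf.
  exact/Bo/Bf.
move=> A /nbhs_prod_topology_box[P Px PA].
have ex i : exists k, [/\ B i (b i k), b i k (x i) & b i k `<=` P i].
  have [_ [_ /(_ (x i) _ (Px i))[U [BU Ux] UP]]] := BP i.
  by have [k kU] := bP i U BU; exists k; rewrite kU.
pose f := [ffun i => projT1 (cid (ex i))].
have fP i : [/\ B i (b i (f i)), b i (f i) (x i) & b i (f i) `<=` P i].
  by rewrite ffunE; case: cid.
exists (box f); first by split=> [|i]; [exists f => // i|]; have [] := fP i.
by move=> y yf; apply: PA => i; have [_ _] := fP i; apply; exact: yf.
Qed.

End FiniteProductTopology.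

(** * The product of complex manifolds *)

Section ProductDifferential.
Variables (R : realType) (m : nat) (n : 'I_m -> nat).
Local Notation N := (\sum_(i < m) n i)%N.
Local Notation V := 'rV[Cplx R]_N.

HB.instance Definition _ i :=
  GRing.isLinear.Build (Cplx R) V 'rV[Cplx R]_(n i) *:%R (@block_proj R m n i)
    (@block_proj_linear R m n i).

(** The inclusion of the factor [i], which has a meaning at the index [k] when
    [k] is in the block [i]. *)
Definition block_embed (i : 'I_m) (u : 'rV[Cplx R]_(n i)) : V :=
  \row_k (if i =P tagnat.sig1 k is ReflectT e
          then u 0 (cast_ord (congr1 n (esym e)) (tagnat.sig2 k)) else 0).

Lemma block_embed_linear i : linear (@block_embed i).
Proof.
move=> a u v; apply/rowP => k; rewrite !mxE; case: eqP => e; rewrite ?mxE//.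
by rewrite mulr0 addr0.
Qed.

HB.instance Definition _ i :=
  GRing.isLinear.Build (Cplx R) 'rV[Cplx R]_(n i) V *:%R (@block_embed i)
    (@block_embed_linear i).

Lemma block_embed_continuous i : continuous (@block_embed i).
Proof.
move=> u; apply: (@cvg_mx _ _ (nbhs u) (nbhs_filter u)) => a k; rewrite mxE.
rewrite (_ : (fun t => _) = fun t : 'rV[Cplx R]_(n i) =>
  if i =P tagnat.sig1 k is ReflectT e
  then t 0 (cast_ord (congr1 n (esym e)) (tagnat.sig2 k)) else 0).
  by case: eqP => e; [exact: coord_continuous|exact: cvg_cst].
by apply/funext => t; rewrite mxE.
Qed.

Lemma sum_block_embed (f : forall i, 'rV[Cplx R]_(n i)) :
  \sum_i block_embed (f i) = \mxrow_i f i.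
Proof.
apply/rowP => k; rewrite summxE (bigD1 (tagnat.sig1 k)) //= [X in _ + X]big1 => [|i ik].
  rewrite addr0 !mxE; case: eqP => // e; congr (f _ _ _).
  by rewrite (eq_irrelevance e (erefl _)) cast_ord_id.
by rewrite mxE; case: eqP ik => // ->; rewrite eqxx.
Qed.

Variable T : forall i, 'rV[Cplx R]_(n i) -> 'rV[Cplx R]_(n i).
Let PT (y : V) : V := \mxrow_i T (block_proj i y).

(** Write the product map as a sum of maps, each going through one factor and
    preceded and followed by continuous linear maps. *)
Lemma differentiable_mxrow (y : V) :
  (forall i, differentiable (@T i) (block_proj i y)) -> differentiable PT y.
Proof.
move=> dT; rewrite (_ : PT = \sum_i (@block_embed i \o (@T i \o @block_proj R m n i))).
  apply: differentiable_sum => i; apply: differentiable_comp.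
    apply: differentiable_comp; last exact: dT.
    exact/linear_differentiable/block_proj_continuous.
  exact/linear_differentiable/block_embed_continuous.
by apply/funext => z; rewrite fct_sumE /PT -sum_block_embed.
Qed.

(** Chain rule for the two sides of proj_i o (product map) = T_i o proj_i. *)
Lemma block_proj_diff_mxrow (y v : V) i :
    (forall i, differentiable (@T i) (block_proj i y)) ->
  block_proj i ('d PT y v) = 'd (@T i) (block_proj i y) (block_proj i v).
Proof.
move=> dT; have dPT := differentiable_mxrow dT.
have dp z : differentiable (@block_proj R m n i) z.
  exact/linear_differentiable/block_proj_continuous.
have dl z u : 'd (@block_proj R m n i) z u = block_proj i u.
  exact: (congr1 (@^~ u) (diff_lin z (@block_proj_continuous R m n i))).
have E1 : 'd (@block_proj R m n i \o PT) y v = block_proj i ('d PT y v).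
  rewrite -(dl (PT y)).
  exact: (congr1 (@^~ v) (diff_comp dPT (dp (PT y)))).
have E2 : 'd (@T i \o @block_proj R m n i) y v =
    'd (@T i) (block_proj i y) (block_proj i v).
  rewrite -(dl y v).
  exact: (congr1 (@^~ v) (diff_comp (dp y) (dT i))).
rewrite -E1 -E2; congr ('d _ y v).
by apply/funext => z; rewrite /= /block_proj mxrowK.
Qed.

End ProductDifferential.

Section ProductManifold.
Variables (R : realType) (m : nat) (n : 'I_m -> nat).
Variable X : forall i, charted_space R (n i).
Local Notation P := (prod_charted X).

Lemma chart_prod (c : chart_index P) (x : P) : 
  chart c x = \mxrow_i chart (c i) (x i).
Proof. by []. Qed.

Lemma block_proj_chart (c : chart_index P) (x : P) i :
  block_proj i (chart c x) = chart (c i) (x i).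
Proof. by rewrite chart_prod /block_proj mxrowK. Qed.

Hypothesis mfd : forall i, complex_manifold (X i).

Let hom i (c : chart_index (X i)) : homeomorphic_chart c.
Proof. by have [_ _ _ /(_ c)] := mfd i. Qed.

Lemma chart_codom_prod (c : chart_index P) :
  chart_codom c = block_preimage (fun i => chart_codom (c i)).
Proof.
apply/seteqP; split=> [_ [x xc <-] i|y yc].
  by rewrite block_proj_chart; exists (x i) => //; exact: xc.
have E i : chart_dom (c i) (chart_inv (c i) (block_proj i y)) /\
    chart (c i) (chart_inv (c i) (block_proj i y)) = block_proj i y.
  have [xi xic <-] := yc i; have [_ _ cK _ _] := hom (c i).
  by rewrite cK ?inE.
exists (chart_inv c y); first by move=> i; have [] := E i.
by rewrite chart_prod -[RHS]submxrowK; apply/mxrowP => i; rewrite !mxrowK (E i).2.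
Qed.

Lemma homeomorphic_chart_prod (c : chart_index P) : homeomorphic_chart c.
Proof.
split.
- rewrite openE => x xc.
  apply: (@nbhs_prod_topology _ _ x (fun i => chart_dom (c i))) => i.
  have [cdo _ _ _ _] := hom (c i); apply: open_nbhs_nbhs; split => //; exact: xc.
- rewrite chart_codom_prod; apply: open_block_preimage => i.
  by have [] := hom (c i).
- move=> x; rewrite inE => xc; apply: functional_extensionality_dep => i.
  rewrite /= mxrowK; have [_ _ cK _ _] := hom (c i); apply: cK.
  by rewrite inE; exact: xc.
- move=> x; rewrite inE => xc.
  apply: (@cvg_mx _ _ (nbhs x) (nbhs_filter x)) => a k; rewrite chart_prod mxE.
  rewrite (_ : (fun t => _) = (fun t : P =>
    chart (c (tagnat.sig1 k)) (t (tagnat.sig1 k)) a (tagnat.sig2 k))).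
    have [_ _ _ cc _] := hom (c (tagnat.sig1 k)).
    have xk : x (tagnat.sig1 k) \in chart_dom (c (tagnat.sig1 k)).
      by rewrite inE; exact: xc.
    have H1 := @prod_topology_proj_continuous _ (fun i => Defs.space (X i))
      (tagnat.sig1 k) x.
    have H3 := @coord_continuous (Cplx R) 1 _ a (tagnat.sig2 k)
      (chart (c (tagnat.sig1 k)) (x (tagnat.sig1 k))).
    exact: (cvg_comp _ _ H1 (cvg_comp _ _ (cc _ xk) H3)).
  by apply/funext => t; rewrite chart_prod mxE.
- move=> y; rewrite inE chart_codom_prod => yc.
  apply: (@cvg_prod_topology _ _ _ _ (fmap_filter _ (nbhs_filter y))) => i.
  have [_ _ _ _ ci] := hom (c i).
  have yi : block_proj i y \in chart_codom (c i) by rewrite inE; exact: yc.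
  exact: (cvg_comp _ _ (@block_proj_continuous R m n i y) (ci _ yi)).
Qed.

Lemma transition_differentiable (c d : chart_index P) (x : P) :
  chart_dom c x -> chart_dom d x ->
  forall i, differentiable (transition (c i) (d i)) (block_proj i (chart c x)).
Proof.
move=> xc xd i; rewrite block_proj_chart; have [_ _ _ _ dt] := mfd i.
by apply: dt; [exact: xc|exact: xd].
Qed.

Lemma complex_manifold_prod : complex_manifold P.
Proof.
split.
- by apply: hausdorff_product => i; have [] := mfd i.
- by apply: second_countable_prod_topology => i; have [] := mfd i.
- move=> x; have ex i : exists c : chart_index (X i), chart_dom c (x i).
    by have [_ _ cov _ _] := mfd i; exact: cov.
  by exists (fun i => projT1 (cid (ex i))) => i; case: cid.
- exact: homeomorphic_chart_prod.
- move=> c d x xc xd; 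
  exact: (differentiable_mxrow (transition_differentiable xc xd)).
Qed.

Lemma block_proj_diff_transition (c d : chart_index P) (x : P) i v :
  chart_dom c x -> chart_dom d x ->
  block_proj i ('d (transition c d) (chart c x) v) =
  'd (transition (c i) (d i)) (chart (c i) (x i)) (block_proj i v).
Proof.
move=> xc xd; rewrite -block_proj_chart.
exact: (block_proj_diff_mxrow v i (transition_differentiable xc xd)).
Qed.

End ProductManifold.

(** * Metrics and forms on the product *)

Section HermitianForms.
Variable R : realType.

(** In matrix form, block products apply to it. *)
Definition sesqui n (h : 'M[Cplx R]_n) (u w : 'rV[Cplx R]_n) : Cplx R :=
  (u *m h *m (map_mx Num.conj w)^T) 0 0.

Lemma sesquiE n (h : 'M[Cplx R]_n) u w :
  sesqui h u w = \sum_j \sum_k h j k * u 0 j * (w 0 k)^*.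
Proof.
rewrite /sesqui mxE exchange_big /=; apply: eq_bigr => k _.
rewrite !mxE big_distrl /=; apply: eq_bigr => j _.
by rewrite [u _ _ * _]mulrC.
Qed.

Lemma wedge_dz_dzbar n (j k : 'I_n) (v : 'M[Cplx R]_(2, n)) :
  wedge (@dz R n j) (@dzbar R n k) v =
  row 0 v 0 j * (row 1 v 0 k)^* - row 1 v 0 j * (row 0 v 0 k)^*.
Proof.
rewrite (wedge_1l (A := Cplx R)); last first.
  by move=> t r; rewrite (_ : t = 1%g) ?odd_perm1 ?row_perm1 ?mul1r//;
    apply/permP => i; rewrite !ord1.
rewrite /row_altsum !big_ord_recl big_ord0 addr0 mul1r mulN1r /dz /dzbar !mxE.
congr (v _ _ * (v _ _)^* - v _ _ * (v _ _)^*); exact: val_inj.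
Qed.

(** The condition that relates a positive (1,1)-form to its Hermitian matrix,
    without coordinates. *)
Lemma sesqui_wedge n (h : 'M[Cplx R]_n) (v : 'M[Cplx R]_(2, n)) :
  \sum_j \sum_k h j k * wedge (@dz R n j) (@dzbar R n k) v =
  sesqui h (row 0 v) (row 1 v) - sesqui h (row 1 v) (row 0 v).
Proof.
rewrite !sesquiE -sumrB; apply: eq_bigr => j _; rewrite -sumrB.
by apply: eq_bigr => k _; rewrite wedge_dz_dzbar mulrBr !mulrA.
Qed.

Variables (m : nat) (n : 'I_m -> nat).
Local Notation N := (\sum_(i < m) n i)%N.
Local Notation V := 'rV[Cplx R]_N.

Lemma sesqui_mxdiag (h : forall i, 'M[Cplx R]_(n i)) (u w : V) :
  sesqui (\mxdiag_i h i) u w = \sum_i sesqui (h i) (block_proj i u) (block_proj i w).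
Proof.
rewrite /sesqui -[u in LHS]submxrowK mul_mxrow_mxdiag.
have -> : (map_mx Num.conj w)^T = \mxcol_i (map_mx Num.conj (block_proj i w))^T.
  rewrite -tr_mxrow; congr _^T; apply/rowP => k.
  by rewrite !mxE tagnat.sig2K.
by rewrite mul_mxrow_mxcol summxE.
Qed.

Lemma mxdiag_hermitian (h : forall i, 'M[Cplx R]_(n i)) :
    (forall i j k, h i k j = (h i j k)^*) ->
  forall j k, (\mxdiag_i h i) k j = ((\mxdiag_i h i) j k)^*.
Proof.
move=> hh j k.
have E i a i' b : (\mxdiag_i h i) (tagnat.Rank i a) (tagnat.Rank i' b) =
    submxblock (\mxdiag_i h i) i i' a b by rewrite !mxE.
rewrite -(tagnat.sig2K j) -(tagnat.sig2K k) !E.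
move: (tagnat.sig2 j) (tagnat.sig2 k).
have [e|ne] := eqVneq (tagnat.sig1 j) (tagnat.sig1 k).
  by case: _ / e => a b; rewrite submxblock_diag hh.
move=> a b; rewrite /mxdiag !mxblockK (negbTE ne) eq_sym (negbTE ne) !mxE.
by rewrite rmorph0.
Qed.

(** The Hermitian matrix of the sum is block diagonal.  A nonzero vector has a
    nonzero component in some factor, which makes the sum positive. *)
Lemma positive_11_sum_form (a : forall i, 'rV[Cplx R]_(n i) -> kform R (n i) R 2) y :
  (forall i, positive_11 (a i (block_proj i y))) -> positive_11 (sum_form a y).
Proof.
move=> apos.
pose h i := projT1 (cid (apos i)).
have hP i := projT2 (cid (apos i)).
exists (\mxdiag_i h i); split.
- by apply: mxdiag_hermitian => i; have [] := hP i.
- move=> u u0; rewrite -sesquiE sesqui_mxdiag.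
  have pos i : block_proj i u != 0 ->
      0 < sesqui (h i) (block_proj i u) (block_proj i u).
    by rewrite sesquiE; have [_ + _] := hP i; exact.
  have ge0 i : 0 <= sesqui (h i) (block_proj i u) (block_proj i u).
    have [->|/pos/ltW//] := eqVneq (block_proj i u) 0.
    by rewrite /sesqui mul0mx mul0mx mxE.
  have [i ui] : exists i, block_proj i u != 0.
    apply/existsP; apply: contraNT u0 => /existsPn u0; apply/eqP.
    by apply/mxrowP => i; move: (u0 i) => /negPn/eqP; rewrite /block_proj => ->;
      rewrite submxrow0.
  by rewrite (bigD1 i) //= ltr_pwDl ?pos ?sumr_ge0.
- move=> v; rewrite sesqui_wedge !sesqui_mxdiag -sumrB big_distrr /=.
  rewrite /sum_form /ofreal (raddf_sum (real_complex R)); apply: eq_bigr => i _.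
  have [_ _ /(_ (submxrow v i))] := hP i.
  by rewrite sesqui_wedge !row_submxrow.
Qed.

End HermitianForms.

Section ProductForms.
Variables (R : realType) (m : nat) (n : 'I_m -> nat).
Variable X : forall i, charted_space R (n i).
Local Notation N := (\sum_(i < m) n i)%N.
Local Notation P := (prod_charted X).
Hypothesis mfd : forall i, complex_manifold (X i).

Definition sum_local_forms k (a : forall i, local_forms (X i) k) :
    local_forms P k :=
  fun c => sum_form (fun i => a i (c i)).

Let codom_open i (c : chart_index (X i)) : open (chart_codom c).
Proof. by have [_ _ _ /(_ c)[]] := mfd i. Qed.

Lemma smooth_sum_local_forms k (a : forall i, local_forms (X i) k) :
  (forall i, smooth_form (a i)) -> smooth_form (sum_local_forms a).
Proof.
move=> sa; split=> [c y|c v l|c d x xc xd].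
- rewrite chart_codom_prod// => yc; apply: alternating_sum_form => i.
  by have [+ _ _] := sa i; apply; exact: yc.
- rewrite chart_codom_prod//; apply: class_C_sum_form => [i|i v'].
    exact: codom_open.
  by have [_ + _] := sa i; exact.
- apply/funext => v; apply: eq_bigr => i _; rewrite !block_proj_chart.
  have [_ _ /(_ (c i) (d i) (x i) (xc i) (xd i)) ->] := sa i.
  rewrite /pullback; congr (a i _ _ _); apply/row_matrixP => j.
  by rewrite row_submxrow !rowK (block_proj_diff_transition mfd _ _ xc xd) row_submxrow.
Qed.

Lemma ext_d_sum_form k (U : forall i, set 'rV[Cplx R]_(n i))
    (a : forall i, 'rV[Cplx R]_(n i) -> kform R (n i) R k) y v :
    (forall i, U i (block_proj i y)) ->
    (forall i v, class_C 1 (U i) (fun z => a i z v)) ->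
  ext_d (sum_form a) y v = \sum_i ext_d (a i) (block_proj i y) (submxrow v i).
Proof.
move=> Uy Ca; rewrite /ext_d exchange_big /=; apply: eq_bigr => j _.
rewrite -big_distrr /=; congr (_ * _).
have D i : is_rderive y (row j v)
    (fun z => a i (block_proj i z) (submxrow (row' j v) i))
    (rderive (row j (submxrow v i)) (fun z => a i z (row' j (submxrow v i)))
      (block_proj i y)).
  have -> : submxrow (row' j v) i = row' j (submxrow v i).
    by apply/matrixP => p q; rewrite !mxE.
  rewrite row_submxrow; 
  exact: (is_rderive_comp (f := fun z => a i z (row' j (submxrow v i)))
    (@block_proj_linear R m n i)
    (rderivableP (class_C1_rderivable (Ca i _) (Uy i)))).
exact: (is_rderiveP (is_rderive_sum _ D)).2.
Qed.

Lemma closed_sum_local_forms k (a : forall i, local_forms (X i) k) :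
  (forall i, smooth_form (a i)) -> (forall i, closed_form (a i)) ->
  closed_form (sum_local_forms a).
Proof.
move=> sa ca c y; rewrite chart_codom_prod// => yc; apply/funext => v.
rewrite (ext_d_sum_form (U := fun i => chart_codom (c i))).
- by rewrite big1// => i _; rewrite (ca i (c i) _ (yc i)).
- exact: yc.
- by move=> i v'; have [_ /(_ (c i) v' 1%N) + _] := sa i.
Qed.

End ProductForms.

Theorem proposition1p2 (R : realType) (m : nat) (n : 'I_m -> nat)
    (X : forall i : 'I_m, charted_space R (n i))
    (hm : (2 <= m)%N)
    (hX : forall i : 'I_m, LC_balanced (X i))
    (hcompact : compact [set: prod_charted X]) :
  LC_balanced (prod_charted X).
Proof.
have mfd i : complex_manifold (X i) by have [] := hX i.
have n_gt1 i : (1 < n i)%N by have [] := hX i.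
split; first exact: complex_manifold_prod.
  case: m n X hm hX {hcompact mfd} n_gt1 => // m n X _ _ n_gt1.
  by rewrite big_ord_recl (leq_trans (n_gt1 ord0))// leq_addr.
pose w i := projT1 (cid (let: And3 _ _ e := hX i in e)).
have wP i := projT2 (cid (let: And3 _ _ e := hX i in e)).
pose th i := projT1 (cid (wP i)).
have thP i := projT2 (cid (wP i)).
exists (sum_local_forms w), (sum_local_forms th); split.
- split; first by apply: smooth_sum_local_forms => // i; have [[]] := thP i.
  move=> c y; rewrite chart_codom_prod// => yc.
  apply: positive_11_sum_form => i.
  by have [[_ +] _ _ _] := thP i; apply; exact: yc.
- by apply: smooth_sum_local_forms => // i; have [] := thP i.
- by apply: closed_sum_local_forms => // i; have [] := thP i.
move=> c y; rewrite chart_codom_prod// => yc.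
apply: (sum_form_LCB (U := fun i => chart_codom (c i))) yc => i.
- exact: ltnW.
- by have [_ _ _ /(_ (c i))[]] := mfd i.
- by move=> v; have [[[_ /(_ (c i) v 1%N) + _] _] _ _ _] := thP i.
- by have [[[+ _ _] _] _ _ _] := thP i; exact.
- by have [_ [+ _ _] _ _] := thP i; exact.
- by have [_ _ _ +] := thP i; exact.
Qed.
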